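(* Let $\mathcal{G}_X$ be the Renault–Deaconu groupoid associated with the ordered prime shift $X$, and let $\hat{\mathcal{G}}_X$ be its cover groupoid, endowed with the length function $\hat\ell = \ell_S\circ\pi$, where $\pi\colon\hat{\mathcal{G}}_X\to\mathcal{G}_X$ is the canonical map and $\ell_S$ is the canonical length function of $\mathcal{G}_X$. Then $\hat{\mathcal{G}}_X$ is an étale groupoid that, with respect to $\hat\ell$, has strong subexponential growth but does not have polynomial growth.
   Context: Ordered prime shift: let $\mathcal{A}=\{0,1\}$ and let the set of forbidden words be $\mathcal{F}=\{10^n1 : n\in\mathbb{N}_0 \text{ not prime}\}\cup\{10^{p_1}10^{p_2}1\cdots10^{p_r}1 : r\ge 2,\ p_i\ge p_{i+1}\text{ for some } i\}$ (with $p_i$ primes). $X\subset\{0,1\}^{\mathbb{N}}$ is the set of all one-sided sequences in which no forbidden word occurs as a block of consecutive letters. It is compact in the product topology and invariant under the shift $\sigma(x)[n]=x[n+1]$. Renault–Deaconu groupoid: $\mathcal{G}_X=\{(x,m-n,y)\in X\times\mathbb{Z}\times X : m,n\in\mathbb{N}_0,\ \sigma^m(x)=\sigma^n(y)\}$ with $(x,k,y)(y,l,z)=(x,k+l,z)$, $(x,k,y)^{-1}=(y,-k,x)$, unit space $\{(x,0,x)\}$ identified with $X$, $r(x,k,y)=x$, $s(x,k,y)=y$. For finite words $u,v$ (possibly empty) of lengths $m,n$ occurring in elements of $X$, let $Z(u,v)=\{(x,m-n,y): x \text{ begins with }u,\ y\text{ begins with }v,\ \sigma^m(x)=\sigma^n(y)\}$.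 These sets form a basis of a locally compact Hausdorff topology; $X$ is open in $\mathcal{G}_X$ and $r,s$ are locally injective, but $\mathcal{G}_X$ is not étale. Canonical length function: $S=\bigcup_{a\in\mathcal{A}}Z(a,\emptyset)\cup Z(\emptyset,a)$ generates $\mathcal{G}_X$; $\ell_S(x)=0$ for $x\in X$ and $\ell_S(g)=\min\{k\in\mathbb{N}: g\in S^k\}$ for $g\in\mathcal{G}_X\setminus X$. Cover groupoid (Brix–Hume–Li): let $D$ be the smallest $C^*$-subalgebra of $\ell^\infty(X)$ that contains $C(X)$ and is such that for all $h\in C_c(\mathcal{G}_X)$ and $d\in D$ the function $x\mapsto\sum_{g\in r^{-1}(x)}h(g)\,d(s(g))$ belongs to $D$. Let $\hat X$ be the Gelfand spectrum of $D$; evaluations embed $X$ (as a set) densely in $\hat X$. Let $A$ be the $C^*$-subalgebra of $\ell^\infty(\mathcal{G}_X)$ (pointwise operations) generated by the functions $f\cdot(d\circ s)$ with $f\in C_c(\mathcal{G}_X)$, $d\in D$, and let $\hat{\mathcal{G}}_X$ be the Gelfand spectrum of $A$, a locally compact Hausdorff space containing $\mathcal{G}_X$ (as a set, via evaluations) densely. The groupoid operations of $\hat{\mathcal{G}}_X$ are the unique continuous extensions of those of $\mathcal{G}_X$; its unit space is $\hat X$. The inclusion $C_0(\mathcal{G}_X)\subset A$ induces the canonical continuous proper map $\pi\colon\hat{\mathcal{G}}_X\to\mathcal{G}_X$. With $\hat s$ the source map, $(\pi,\hat s)$ identifies points of $\hat{\mathcal{G}}_X$ with pairs $(g,\hat x)$,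 $g\in\mathcal{G}_X$, $\hat x\in\hat X$, so that $\hat{\mathcal{G}}_X$ is viewed as a transformation groupoid $\mathcal{G}_X\ltimes\hat X$ and $\hat\ell(g,\hat x)=\ell_S(g)$. An étale groupoid is a locally compact Hausdorff groupoid whose range and source maps are local homeomorphisms. For a groupoid $\mathcal{H}$ with a locally bounded (bounded on compact sets) length function $\ell$ (i.e. $\ell\ge0$, zero on units, $\ell(x^{-1})=\ell(x)$, $\ell(xy)\le\ell(x)+\ell(y)$), let $B_{\mathcal{H}_u}(t)=\{x\in\mathcal{H}: s(x)=u,\ \ell(x)\le t\}$. Polynomial growth: there are $C>0$, $d\in\mathbb{N}$ with $\sup_{u\in \mathcal{H}^{(0)}}|B_{\mathcal{H}_u}(t)|\le C(1+t)^d$ for all $t\ge0$. Strong subexponential growth: there are $C,\alpha>0$, $0<\beta<1$ with $\sup_{u\in \mathcal{H}^{(0)}}|B_{\mathcal{H}_u}(t)|\le C\exp(\alpha t^\beta)$ for all $t\ge0$. *)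

(* Defs.v *)
From HB Require Import structures.
From mathcomp Require Import all_boot all_order all_algebra.
From mathcomp Require Import complex.
From mathcomp Require Import all_classical all_reals all_analysis.
From mathcomp Require Import zify.
Set Implicit Arguments.
Unset Strict Implicit.
Unset Printing Implicit Defensive.
Import Order.TTheory GRing.Theory Num.Theory.
Import numFieldNormedType.Exports.
Local Open Scope classical_set_scope.
Local Open Scope ring_scope.

(** * Groupoids, length functions, growth *)

(* A (small) groupoid with arrows [H] and unit space [U].  The product
   [gmul g h] is only meaningful when [gsrc g = grng h]. *)
Record groupoid_ops (U H : Type) := GroupoidOps {
  gsrc : H -> U;
  grng : H -> U;
  gunit : U -> H;
  ginv : H -> H;
  gmul : H -> H -> H }.

Definition composable (U H : Type) (G : groupoid_ops U H) : set (H * H) :=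
  [set p | gsrc G p.1 = grng G p.2].

Record same_groupoid (U H : Type) (G1 G2 : groupoid_ops U H) : Prop := {
  same_src : gsrc G1 =1 gsrc G2;
  same_rng : grng G1 =1 grng G2;
  same_unit : gunit G1 =1 gunit G2;
  same_inv : ginv G1 =1 ginv G2;
  same_mul : forall p, composable G1 p ->
    gmul G1 p.1 p.2 = gmul G2 p.1 p.2 }.

Record is_groupoid (U H : Type) (G : groupoid_ops U H) : Prop := {
  src_unit : forall u, gsrc G (gunit G u) = u;
  rng_unit : forall u, grng G (gunit G u) = u;
  src_mul : forall g h, gsrc G g = grng G h -> gsrc G (gmul G g h) = gsrc G h;
  rng_mul : forall g h, gsrc G g = grng G h -> grng G (gmul G g h) = grng G g;
  mul_assoc : forall g h k, gsrc G g = grng G h -> gsrc G h = grng G k ->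
    gmul G (gmul G g h) k = gmul G g (gmul G h k);
  mul_unitl : forall g, gmul G (gunit G (grng G g)) g = g;
  mul_unitr : forall g, gmul G g (gunit G (gsrc G g)) = g;
  src_inv : forall g, gsrc G (ginv G g) = grng G g;
  rng_inv : forall g, grng G (ginv G g) = gsrc G g;
  mul_invl : forall g, gmul G (ginv G g) g = gunit G (gsrc G g);
  mul_invr : forall g, gmul G g (ginv G g) = gunit G (grng G g) }.

Record continuous_ops (U H : topologicalType) (G : groupoid_ops U H) : Prop := {
  ops_src_continuous : continuous (gsrc G);
  ops_rng_continuous : continuous (grng G);
  ops_unit_continuous : continuous (gunit G);
  ops_inv_continuous : continuous (ginv G);
  ops_mul_continuous :
    {within composable G, continuous (fun p : H * H => gmul G p.1 p.2)} }.

Definition local_homeomorphism (S T : topologicalType) (f : S -> T) : Prop :=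
  forall x : S, exists O : set S,
    [/\ open O, O x, open (f @` O), {within O, continuous f} &
     exists2 f' : T -> S, {within f @` O, continuous f'} &
                          forall y, O y -> f' (f y) = y].

Record etale_groupoid (U H : topologicalType) (G : groupoid_ops U H) : Prop := {
  etale_is_groupoid : is_groupoid G;
  etale_continuous : continuous_ops G;
  etale_hausdorff : hausdorff_space H;
  etale_locally_compact : locally_compact [set: H];
  etale_src : local_homeomorphism (gsrc G);
  etale_rng : local_homeomorphism (grng G) }.

Record length_function (R : realType) (U H : Type) (G : groupoid_ops U H)
    (l : H -> R) : Prop := {
  length_ge0 : forall g, 0 <= l g;
  length_unit : forall u, l (gunit G u) = 0;
  length_inv : forall g, l (ginv G g) = l g;
  length_mul : forall g h, gsrc G g = grng G h ->
    l (gmul G g h) <= l g + l h }.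

Definition locally_bounded (R : realType) (H : topologicalType) (l : H -> R) :=
  forall K : set H, compact K -> exists M : R, forall g, K g -> l g <= M.

Definition fibre_ball (R : realType) (U H : Type) (G : groupoid_ops U H)
    (l : H -> R) (u : U) (t : R) : set H :=
  [set g | gsrc G g = u /\ l g <= t].

(* [counting A] is the cardinality of [A], [+oo] if [A] is infinite. *)
Definition growth (R : realType) (U : Type) (H : choiceType)
    (G : groupoid_ops U H) (l : H -> R) (t : R) : \bar R :=
  ereal_sup [set counting (fibre_ball G l u t) | u in [set: U]].

Definition polynomial_growth (R : realType) (U : Type) (H : choiceType)
    (G : groupoid_ops U H) (l : H -> R) : Prop :=
  exists (C : R) (d : nat), 0 < C /\
    forall t : R, 0 <= t -> (growth G l t <= (C * (1 + t) ^+ d)%:E)%E.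

Definition strong_subexponential_growth (R : realType) (U : Type)
    (H : choiceType) (G : groupoid_ops U H) (l : H -> R) : Prop :=
  exists C alpha beta : R, [/\ 0 < C, 0 < alpha, 0 < beta < 1 &
    forall t : R, 0 <= t ->
      (growth G l t <= (C * expR (alpha * t `^ beta))%:E)%E].

(** * The ordered prime shift *)

Definition occurs (w : seq bool) (x : nat -> bool) : Prop :=
  exists i, mkseq (fun j => x (i + j)%N) (size w) = w.

Definition begins_with (w : seq bool) (x : nat -> bool) : Prop :=
  mkseq x (size w) = w.

(* [gap_word [:: n1; ..; nr]] is the word 1 0^n1 1 0^n2 1 .. 1 0^nr 1. *)
Definition gap_word (ns : seq nat) : seq bool :=
  true :: flatten [seq rcons (nseq n false) true | n <- ns].

Definition forbidden : set (seq bool) :=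
  [set w | exists2 n, ~~ prime n & w = gap_word [:: n]] `|`
  [set w | exists ps, [/\ (2 <= size ps)%N, all prime ps,
     exists2 i, (i.+1 < size ps)%N & (nth 0 ps i >= nth 0 ps i.+1)%N &
     w = gap_word ps]].

Definition ops_set : set cantor_space :=
  [set x | forall w, forbidden w -> ~ occurs w x].

(* [set_type] carries the subspace topology. *)
Definition X : topologicalType := set_type ops_set.

Definition letters (x : X) : nat -> bool := set_val x.

Lemma letters_inj : injective letters.
Proof. exact: val_inj. Qed.

Lemma ops_set_zero : ops_set (fun=> false).
Proof.
move=> w Fw [i Ew].
have [ns Ens] : exists ns, w = gap_word ns.
  by case: Fw => [[n _ ->]|[ps [_ _ _ ->]]]; [exists [:: n]|exists ps].
by move: Ew; rewrite Ens.
Qed.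

Definition Xzero : X := SigSub (mem_set ops_set_zero).

Lemma ops_set_shift (x : X) : ops_set (fun n => letters x n.+1).
Proof.
move=> w Fw [i Ew].
have xP : ops_set (set_val x) by exact: (set_mem (valP x)).
apply: (xP w Fw); exists i.+1; rewrite -[RHS]Ew.
by apply: eq_mkseq => j; rewrite addSn.
Qed.

Definition shift (x : X) : X := SigSub (mem_set (@ops_set_shift x)).

(** * The Renault-Deaconu groupoid *)

Record GX := MkGX {
  grange : X;
  gdeg : int;
  gsource : X;
  gxP : exists m n : nat,
    gdeg = m%:Z - n%:Z /\ iter m shift grange = iter n shift gsource }.

Lemma GX_eq (g h : GX) : grange g = grange h -> gdeg g = gdeg h ->
  gsource g = gsource h -> g = h.
Proof.
case: g h => [x k y p] [x' k' y' q] /= xx' kk' yy'; subst.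
by rewrite (Prop_irrelevance p q).
Qed.

HB.instance Definition _ := gen_eqMixin GX.
HB.instance Definition _ := gen_choiceMixin GX.

Lemma GX_unitP (x : X) : exists m n : nat,
  0 = m%:Z - n%:Z :> int /\ iter m shift x = iter n shift x.
Proof. by exists 0%N, 0%N; rewrite subrr. Qed.

Definition GX_unit (x : X) : GX := MkGX (GX_unitP x).

Lemma GX_invP (g : GX) : exists m n : nat,
  - gdeg g = m%:Z - n%:Z :> int /\
  iter m shift (gsource g) = iter n shift (grange g).
Proof.
by have [m [n [-> E]]] := gxP g; exists n, m; split; rewrite ?opprB.
Qed.

Definition GX_inv (g : GX) : GX := MkGX (GX_invP g).

Lemma GX_mulP (g h : GX) : gsource g = grange h -> exists m n : nat,
  gdeg g + gdeg h = m%:Z - n%:Z :> int /\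
  iter m shift (grange g) = iter n shift (gsource h).
Proof.
have [m [n [-> E]]] := gxP g; have [p [q [-> F]]] := gxP h => sr.
exists (p + m)%N, (n + q)%N; split; first by lia.
by rewrite iterD E sr -iterD addnC iterD F -iterD.
Qed.

Definition GX_mul (g h : GX) : GX :=
  if pselect (gsource g = grange h) is left e then MkGX (GX_mulP e) else g.

Definition GX_groupoid : groupoid_ops X GX :=
  GroupoidOps gsource grange GX_unit GX_inv GX_mul.

Definition Z (u v : seq bool) : set GX :=
  [set g | [/\ begins_with u (letters (grange g)),
               begins_with v (letters (gsource g)),
               gdeg g = (size u)%:Z - (size v)%:Z &
               iter (size u) shift (grange g) =
               iter (size v) shift (gsource g)]].

Definition in_language (w : seq bool) : Prop := exists x : X, occurs w (letters x).

Lemma letters_iter_shift (x : X) m i :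
  letters (iter m shift x) i = letters x (m + i)%N.
Proof.
elim: m i => [|m IH] i //=.
by rewrite -[LHS]/(letters (iter m shift x) i.+1) IH addnS.
Qed.

Lemma begins_withP w x :
  begins_with w x <-> forall j, (j < size w)%N -> x j = nth false w j.
Proof.
split=> [E j jw|E]; first by rewrite -[in RHS]E nth_mkseq.
apply: (@eq_from_nth _ false); rewrite size_mkseq // => j jw.
by rewrite nth_mkseq // E.
Qed.

Lemma Z_cover :
  \bigcup_(uv in [set uv | in_language uv.1 /\ in_language uv.2])
    Z uv.1 uv.2 = setT.
Proof.
rewrite -subTset => g _; have [m [n [dg E]]] := gxP g.
exists (mkseq (letters (grange g)) m, mkseq (letters (gsource g)) n) => /=.
  by split; [exists (grange g)|exists (gsource g)]; exists 0%N; rewrite size_mkseq.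
by split; rewrite /begins_with ?size_mkseq.
Qed.

Lemma Z_sub (u v u' v' : seq bool) (g : GX) :
  Z u v g -> Z u' v' g -> (size u <= size u')%N -> Z u' v' `<=` Z u v.
Proof.
case=> /begins_withP bu /begins_withP bv dg Eg.
case=> /begins_withP bu' /begins_withP bv' dg' Eg' uu'.
have vv' : (size v <= size v')%N by lia.
move=> h [/begins_withP cu' /begins_withP cv' dh Eh]; split.
- apply/begins_withP => j ju; have ju' := leq_trans ju uu'.
  by rewrite cu' // -bu' // bu.
- apply/begins_withP => j jv; have jv' := leq_trans jv vv'.
  by rewrite cv' // -bv' // bv.
- by lia.
- apply: letters_inj; apply: funext => i; rewrite !letters_iter_shift.
  have [iu|iu] := ltnP (size u + i) (size u').
    have iv : (size v + i < size v')%N by lia.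
    rewrite cu' // cv' // -bu' // -bv' // -!letters_iter_shift.
    by rewrite Eg.
  have -> : (size u + i = size u' + (size u + i - size u'))%N by lia.
  have -> : (size v + i = size v' + (size u + i - size u'))%N by lia.
  by rewrite -!letters_iter_shift Eh.
Qed.

Lemma Z_join (uv uv' : seq bool * seq bool) (g : GX) :
  [set uv | in_language uv.1 /\ in_language uv.2] uv ->
  [set uv | in_language uv.1 /\ in_language uv.2] uv' ->
  Z uv.1 uv.2 g -> Z uv'.1 uv'.2 g ->
  exists uv'', [/\ [set uv | in_language uv.1 /\ in_language uv.2] uv'',
    Z uv''.1 uv''.2 g & Z uv''.1 uv''.2 `<=` Z uv.1 uv.2 `&` Z uv'.1 uv'.2].
Proof.
move=> D D' zg zg'; have [le|/ltnW le] := leqP (size uv.1) (size uv'.1).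
  by exists uv'; split=> // h hz; split=> //; exact: Z_sub zg zg' le h hz.
by exists uv; split=> // h hz; split=> //; exact: Z_sub zg' zg le h hz.
Qed.

HB.instance Definition _ := isPointed.Build (seq bool) [::].

HB.instance Definition _ := @isBaseTopological.Build GX
  (seq bool * seq bool)%type
  [set uv | in_language uv.1 /\ in_language uv.2]
  (fun uv => Z uv.1 uv.2) Z_cover Z_join.

(** * The canonical length function *)

Definition Sgen : set GX :=
  \bigcup_(a in [set: bool]) (Z [:: a] [::] `|` Z [::] [:: a]).

Definition set_product (A B : set GX) : set GX :=
  [set g | exists a b, [/\ A a, B b, gsource a = grange b & g = GX_mul a b]].

(* [Spow 0] is the unit space, the identity for products of subsets. *)
Definition Spow (k : nat) : set GX := iter k (set_product Sgen) (range GX_unit).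

Lemma Sgen_generates (g : GX) : exists k, (0 < k)%N && `[< Spow k g >].
Proof.
have H : forall m n (h : GX), gdeg h = m%:Z - n%:Z ->
    iter m shift (grange h) = iter n shift (gsource h) -> Spow (m + n) h.
  elim=> [|m IHm].
    elim=> [|n IHn] h dh /= Eh.
      by exists (grange h) => //; apply: GX_eq.
    have p1 : exists p q : nat, (-1 : int) = p%:Z - q%:Z /\
      iter p shift (grange h) = iter q shift (iter n shift (gsource h)).
      by exists 0%N, 1%N.
    have p2 : exists p q : nat, (- n%:Z : int) = p%:Z - q%:Z /\
      iter p shift (iter n shift (gsource h)) = iter q shift (gsource h).
      by exists 0%N, n; rewrite sub0r.
    exists (MkGX p1), (MkGX p2); split=> //=.
    - exists (letters (iter n shift (gsource h)) 0) => //; right; split=> //.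
    - by apply: IHn; rewrite //= sub0r.
    - rewrite /GX_mul; case: pselect => // e; apply: GX_eq => //=.
      by rewrite dh; lia.
  move=> n h dh Eh.
  have p1 : exists p q : nat, (1 : int) = p%:Z - q%:Z /\
    iter p shift (grange h) = iter q shift (shift (grange h)).
    by exists 1%N, 0%N.
  have E2 : iter m shift (shift (grange h)) = iter n shift (gsource h).
    by rewrite -iterSr.
  have p2 : exists p q : nat, (m%:Z - n%:Z : int) = p%:Z - q%:Z /\
    iter p shift (shift (grange h)) = iter q shift (gsource h).
    by exists m, n.
  exists (MkGX p1), (MkGX p2); split=> //=.
  - by exists (letters (grange h) 0) => //; left; split.
  - exact: IHm.
  - rewrite /GX_mul; case: pselect => // e; apply: GX_eq => //=.
    by rewrite dh; lia.
have [m [n [dg Eg]]] := gxP g.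
exists (m.+1 + n.+1)%N; rewrite addSn /=; apply/asboolP.
apply: (H m.+1 n.+1) => /=; first by lia.
by rewrite Eg.
Qed.

Definition ell (g : GX) : nat :=
  if `[< range GX_unit g >] then 0%N else ex_minn (Sgen_generates g).

(** * Commutative C*-algebras of bounded functions and their spectra *)

(* The alias makes the topology of a [numClosedFieldType] available on [R[i]]. *)
Definition Cx (R : realType) : numClosedFieldType := R[i].

Definition real_to_Cx (R : realType) (x : R) : Cx R := (x%:C)%C.

(* C*-subalgebras of the bounded functions on [T], for pointwise operations
   and the supremum norm. *)
Record cstar_subalgebra (R : realType) (T : Type) (B : set (T -> Cx R)) :
    Prop := {
  cstar_bounded : forall f, B f ->
    exists M : R, forall t, `|f t| <= real_to_Cx M;
  cstar_0 : B (fun=> 0);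
  cstar_add : forall f g, B f -> B g -> B (fun t => f t + g t);
  cstar_scale : forall (c : Cx R) f, B f -> B (fun t => c * f t);
  cstar_mul : forall f g, B f -> B g -> B (fun t => f t * g t);
  cstar_conj : forall f, B f -> B (fun t => (f t)^*%R);
  cstar_closed : forall f,
    (forall e : R, 0 < e ->
       exists2 g, B g & forall t, `|f t - g t| <= real_to_Cx e) -> B f }.

Record is_character (R : realType) (T : Type) (B : set (T -> Cx R))
    (phi : set_type B -> Cx R) : Prop := {
  character_add : forall f g h : set_type B,
    (forall t, set_val h t = set_val f t + set_val g t) ->
    phi h = phi f + phi g;
  character_scale : forall (c : Cx R) (f h : set_type B),
    (forall t, set_val h t = c * set_val f t) -> phi h = c * phi f;
  character_mul : forall f g h : set_type B,
    (forall t, set_val h t = set_val f t * set_val g t) ->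
    phi h = phi f * phi g;
  character_neq0 : exists f, phi f != 0 }.

(* The Gelfand spectrum, with the topology of pointwise convergence. *)
Definition spectrum (R : realType) (T : Type) (B : set (T -> Cx R)) :
    topologicalType :=
  set_type [set phi : prod_topology (fun _ : set_type B => Cx R) |
            is_character phi].

Definition spectrum_app (R : realType) (T : Type) (B : set (T -> Cx R))
    (phi : spectrum B) : set_type B -> Cx R := set_val phi.

Definition is_evaluation (R : realType) (T : Type) (B : set (T -> Cx R))
    (t : T) (phi : spectrum B) : Prop :=
  forall f : set_type B, spectrum_app phi f = set_val f t.

(** * The cover groupoid *)

Definition Cc (R : realType) (T : topologicalType) : set (T -> Cx R) :=
  [set f | continuous f /\ compact (closure [set t | f t != 0])].

Definition C0 (R : realType) (T : topologicalType) : set (T -> Cx R) :=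
  [set f | continuous f /\
     forall e : R, 0 < e -> exists2 K : set T, compact K &
       forall t, ~ K t -> `|f t| < real_to_Cx e].

(* [\sum_(g \in A)] is the sum over the support, which is finite here: a
   compact subset of [GX] meets each fibre of [grange] in a finite set. *)
Definition convolve (R : realType) (h : GX -> Cx R) (d : X -> Cx R) :
    X -> Cx R :=
  fun x => \sum_(g \in [set g | grange g = x]) (h g * d (gsource g)).

Definition Dalg (R : realType) : set (X -> Cx R) :=
  smallest
    [set B | cstar_subalgebra B /\
       forall h d, @Cc R GX h -> B d -> B (convolve h d)]
    [set f : X -> Cx R | continuous f].

Definition Aalg (R : realType) : set (GX -> Cx R) :=
  smallest (@cstar_subalgebra R GX)
    [set a | exists f d, [/\ @Cc R GX f, @Dalg R d &
       a = (fun g => f g * d (gsource g))]].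

Definition Xhat (R : realType) : topologicalType := spectrum (@Dalg R).
Definition Ghat (R : realType) : topologicalType := spectrum (@Aalg R).

(* The operations of [G] extend those of [GX] continuously, [X] and [GX] being
   embedded in [Xhat R] and [Ghat R] by evaluations. *)
Record continuous_extension (R : realType)
    (G : groupoid_ops (Xhat R) (Ghat R)) : Prop := {
  extension_continuous : continuous_ops G;
  extension_src : forall g (phi : Ghat R), is_evaluation g phi ->
    is_evaluation (gsource g) (gsrc G phi);
  extension_rng : forall g (phi : Ghat R), is_evaluation g phi ->
    is_evaluation (grange g) (grng G phi);
  extension_unit : forall x (chi : Xhat R), is_evaluation x chi ->
    is_evaluation (GX_unit x) (gunit G chi);
  extension_inv : forall g (phi : Ghat R), is_evaluation g phi ->
    is_evaluation (GX_inv g) (ginv G phi);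
  extension_mul : forall g h (phi psi : Ghat R), gsource g = grange h ->
    is_evaluation g phi -> is_evaluation h psi ->
    is_evaluation (GX_mul g h) (gmul G phi psi) }.

(* The canonical map: [cover_map phi] is the point of [GX] at which the
   restriction of [phi] to [C0 R GX], a subalgebra of [Aalg R], is the
   evaluation.  Such a point exists and is unique; the default value
   [GX_unit Xzero] is never taken. *)
Definition cover_map (R : realType) (phi : Ghat R) : GX :=
  xget (GX_unit Xzero)
    [set g | forall f : set_type (@Aalg R), @C0 R GX (set_val f) ->
       spectrum_app phi f = set_val f g].

Definition ell_hat (R : realType) (phi : Ghat R) : R := (ell (cover_map phi))%:R.

(* Main.v *)
(* A character of a C*-algebra [B] of bounded functions on [T] is a limit along a
   filter of points of [T]; since the filter determines the character, every operation
   on the cover is transported from [GX] along such filters.  On the clopen bisection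
   [Z u v] the source is injective, and pushing functions forward along it sends [A]
   into [D]: hence a point of [Ghat] is determined by its image in [GX] and its source,
   the source is a local homeomorphism, and the groupoid laws reduce to those of [GX].

   The ball of radius [t] in a fibre then embeds in the set of the [x] with
   [shift^m x = shift^n y], [m + n <= t], hence is controlled by the prefixes of length
   at most [t].  The gaps between ones increase strictly, so such a prefix has
   [O(sqrt t)] ones, which gives the bound [exp (O(t^(3/4)))].  Conversely, over the
   zero sequence every set of primes below [N] yields a point at distance [O(N^2)],
   and by Chebyshev [2 ^ pi(N)] exceeds every power of [N]. *)
From mathcomp Require Import all_boot all_order all_algebra.
From mathcomp Require Import complex.
From mathcomp Require Import all_classical all_reals all_analysis.
From mathcomp Require Import zify ring lra.
Require Import Defs.
Set Implicit Arguments.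
Unset Strict Implicit.
Unset Printing Implicit Defensive.
Import Order.TTheory GRing.Theory Num.Theory.
Import numFieldNormedType.Exports.
Local Open Scope classical_set_scope.
Local Open Scope ring_scope.

(** * Complex numbers *)

(** On [Z u v] the source of [GX] is injective, but the source image of [Z u v] is in general only
    closed in [X]; this is how [GX] fails to be étale. The indicator of that image is the
    convolution of a cylinder indicator with the constant 1, so it lies in [Dalg] and becomes a
    continuous function on [Xhat]. This is why the source becomes an open map on the cover. [Aalg]
    is not assumed unital: points near a character are described by multipliers, and every limit
    argument first locates a cylinder on which the character takes the value 1. The product is the
    only operation with two arguments, and the filters of two characters live on unrelated arrows. A
    composable pair is therefore realised along one filter, that of the right factor, by lifting
    ranges through a bisection around the left factor. The larger unit space does not enlarge the
    balls, because [cover_map] is injective on each source fibre. A ball is counted by lists of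
    [O(sqrt t)] positions, which gives [exp (O(sqrt t * log t))]; the exponent [3/4] comes from
    [log (1 + t) <= 4 * t^(1/4)]. *)

Section ComplexNumbers.
Variable R : realType.
Local Notation C := (Cx R).
Local Notation "r %:X" := (real_to_Cx r : C) (at level 2, format "r %:X").

Lemma toCxD (x y : R) : (x + y)%:X = x%:X + y%:X.
Proof. exact: (rmorphD (@real_complex R)). Qed.

Lemma toCxN (x : R) : (- x)%:X = - x%:X.
Proof. exact: (rmorphN (@real_complex R)). Qed.

Lemma toCxM (x y : R) : (x * y)%:X = x%:X * y%:X.
Proof. exact: (rmorphM (@real_complex R)). Qed.

Lemma toCx0 : 0%:X = 0. Proof. by []. Qed.

Lemma toCx1 : 1%:X = 1. Proof. by []. Qed.

Lemma toCxX (x : R) n : (x ^+ n)%:X = x%:X ^+ n.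
Proof. exact: (rmorphXn (@real_complex R)). Qed.

Lemma toCxV (x : R) : (x^-1)%:X = (x%:X)^-1.
Proof. exact: (fmorphV (@real_complex R)). Qed.

Lemma toCx_le (x y : R) : (x%:X <= y%:X) = (x <= y).
Proof. exact: lecR. Qed.

Lemma toCx_lt (x y : R) : (x%:X < y%:X) = (x < y).
Proof. exact: ltcR. Qed.

Lemma toCx_real (x : R) : x%:X \is Num.real.
Proof. by rewrite realE -!toCx0 !toCx_le le_total. Qed.

Lemma toCx_inj : injective (fun x : R => x%:X).
Proof. by move=> x y [->]. Qed.

Lemma Cx_ge0_real (z : C) : 0 <= z -> exists2 r : R, 0 <= r & z = r%:X.
Proof.
case: z => a b; rewrite lecE /= => /andP[/eqP -> a0]; by exists a.
Qed.

Lemma toCx_norm (x : R) : `|x%:X| = `|x|%:X.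
Proof.
have [x0|x0] := leP 0 x.
  by rewrite !ger0_norm // -toCx0 toCx_le.
rewrite (ler0_norm (ltW x0)) ler0_norm ?toCxN //.
by rewrite -toCx0 toCx_le ltW.
Qed.

Lemma Cx_norm_real (z : C) : exists2 r : R, 0 <= r & `|z| = r%:X.
Proof. exact/Cx_ge0_real/normr_ge0. Qed.

Lemma cvgCxP (I : Type) (F : set_system I) (f : I -> C) (l : C) : Filter F ->
  f @ F --> l <->
  forall e : R, 0 < e -> \forall t \near F, `|f t - l| < e%:X.
Proof.
move=> FF; split.
  move=> /cvgrPdist_lt H e e0; have := H e%:X; rewrite -{1}toCx0 toCx_lt => /(_ e0).
  by apply: filterS => t; rewrite distrC.
move=> H; apply/cvgrPdist_lt => e e0.
have [r r0 E] := Cx_ge0_real (ltW e0); move: e0; rewrite E -toCx0 toCx_lt => /H.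
by apply: filterS => t; rewrite distrC.
Qed.

Lemma Cx_cvg_unique (I : Type) (F : set_system I) (f : I -> C) (l l' : C) :
  ProperFilter F -> f @ F --> l -> f @ F --> l' -> l = l'.
Proof. by move=> FF; apply: norm_cvg_unique. Qed.

End ComplexNumbers.
Notation "r %:X" := (real_to_Cx r : Cx _) (at level 2, format "r %:X").

(** * Characters as limits along filters *)

Existing Class cstar_subalgebra.

Section Spectrum.
Variables (R : realType) (T : Type) (B : set (T -> Cx R)).
Hypothesis cB : cstar_subalgebra B.
Local Notation C := (Cx R).

Definition app (phi : spectrum B) (f : T -> C) : C :=
  if pselect (B f) is left Bf then spectrum_app phi (exist _ f (mem_set Bf))
  else 0.

Lemma appE (phi : spectrum B) (f : set_type B) :
  spectrum_app phi f = app phi (set_val f).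
Proof.
rewrite /app; case: pselect => [Bf|nB]; last by case: nB; exact: set_valP.
by congr spectrum_app; exact: val_inj.
Qed.

Lemma app_val (phi : spectrum B) f (Bf : B f) :
  app phi f = spectrum_app phi (exist _ f (mem_set Bf)).
Proof. by rewrite appE. Qed.

Lemma spectrum_eq (phi psi : spectrum B) :
  (forall f, B f -> app phi f = app psi f) -> phi = psi.
Proof.
move=> H; apply: val_inj; apply: functional_extensionality_dep => f.
by change (spectrum_app phi f = spectrum_app psi f); rewrite !appE H //; exact: set_valP.
Qed.

Lemma spectrumP (phi : spectrum B) : is_character (spectrum_app phi).
Proof. exact: (set_mem (valP phi)). Qed.

Lemma appD phi f g : B f -> B g ->
  app phi (fun t => f t + g t) = app phi f + app phi g.
Proof.
move=> Bf Bg; rewrite (app_val _ Bf) (app_val _ Bg) (app_val _ (cstar_add cB Bf Bg)).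
exact: (character_add (spectrumP phi)).
Qed.

Lemma appZ phi c f : B f -> app phi (fun t => c * f t) = c * app phi f.
Proof.
move=> Bf; rewrite (app_val _ Bf) (app_val _ (cstar_scale cB c Bf)).
exact: (character_scale (spectrumP phi)).
Qed.

Lemma appM phi f g : B f -> B g ->
  app phi (fun t => f t * g t) = app phi f * app phi g.
Proof.
move=> Bf Bg; rewrite (app_val _ Bf) (app_val _ Bg) (app_val _ (cstar_mul cB Bf Bg)).
exact: (character_mul (spectrumP phi)).
Qed.

Lemma app_neq0 phi : exists2 f, B f & app phi f != 0.
Proof.
have [f f0] := character_neq0 (spectrumP phi).
by exists (set_val f); [exact: set_valP|rewrite -appE].
Qed.

(** [Phi i] is any multiplicative functional, not just an evaluation, so that the lemma serves for
    limits of points and, in [spectrum_ultra], for limits of characters. The last hypothesis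
    excludes the zero functional. *)
Lemma lim_character (I : Type) (F : set_system I) (Phi : I -> (T -> C) -> C) :
  ProperFilter F ->
  (forall i f g, B f -> B g -> Phi i (fun t => f t + g t) = Phi i f + Phi i g) ->
  (forall i c f, B f -> Phi i (fun t => c * f t) = c * Phi i f) ->
  (forall i f g, B f -> B g -> Phi i (fun t => f t * g t) = Phi i f * Phi i g) ->
  (forall f, B f -> exists l : C, Phi ^~ f @ F --> l) ->
  (exists f (l : C), [/\ B f, l != 0 & Phi ^~ f @ F --> l]) ->
  exists phi : spectrum B, forall f, B f -> Phi ^~ f @ F --> app phi f.
Proof.
move=> FF PD PZ PM Pl [f0 [l0 [Bf0 l00 f0l0]]].
have /choice[p pP] : forall f : set_type B, exists l : C, Phi ^~ (set_val f) @ F --> l.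
  by move=> f; apply: Pl; exact: set_valP.
have pU f l : Phi ^~ (set_val f) @ F --> l -> p f = l.
  by move=> fl; exact: Cx_cvg_unique _ (pP f) fl.
have pC : is_character p.
  split.
  - move=> f g h E; apply: pU; have -> : set_val h = (fun t => set_val f t + set_val g t).
      by apply: functional_extensionality_dep => t; exact: E.
    have -> : Phi ^~ (fun t => set_val f t + set_val g t) =
        (fun i => Phi i (set_val f) + Phi i (set_val g)).
      by apply: functional_extensionality_dep => i; rewrite PD //; exact: set_valP.
    by apply: cvgD; exact: pP.
  - move=> c f h E; apply: pU; have -> : set_val h = (fun t => c * set_val f t).
      by apply: functional_extensionality_dep => t; exact: E.
    have -> : Phi ^~ (fun t => c * set_val f t) = (fun i => c * Phi i (set_val f)).
      by apply: functional_extensionality_dep => i; rewrite PZ //; exact: set_valP.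
    by apply: cvgMr; exact: pP.
  - move=> f g h E; apply: pU; have -> : set_val h = (fun t => set_val f t * set_val g t).
      by apply: functional_extensionality_dep => t; exact: E.
    have -> : Phi ^~ (fun t => set_val f t * set_val g t) =
        (fun i => Phi i (set_val f) * Phi i (set_val g)).
      by apply: functional_extensionality_dep => i; rewrite PM //; exact: set_valP.
    by apply: cvgM; exact: pP.
  - by exists (exist _ f0 (mem_set Bf0)); rewrite (pU (exist _ f0 (mem_set Bf0)) _ f0l0).
exists (exist _ p (mem_set pC)) => f Bf; rewrite (app_val _ Bf).
exact: (pP (exist _ f (mem_set Bf))).
Qed.

Definition tends (I : Type) (F : set_system I) (k : I -> T) (phi : spectrum B) :=
  forall f, B f -> f \o k @ F --> app phi f.

Lemma tends_unique (I : Type) (F : set_system I) (k : I -> T) phi psi :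
  ProperFilter F -> tends F k phi -> tends F k psi -> phi = psi.
Proof.
move=> FF h1 h2; apply: spectrum_eq => f Bf.
exact: Cx_cvg_unique _ (h1 f Bf) (h2 f Bf).
Qed.

Lemma tends_exists (I : Type) (F : set_system I) (k : I -> T) :
  ProperFilter F ->
  (forall f, B f -> exists l : C, f \o k @ F --> l) ->
  (exists f (l : C), [/\ B f, l != 0 & f \o k @ F --> l]) ->
  exists phi, tends F k phi.
Proof. by move=> FF; exact: (lim_character (Phi := fun i f => f (k i))). Qed.

Lemma cstar_sub f g : B f -> B g -> B (fun t => f t - g t).
Proof.
move=> Bf Bg; have := cstar_add cB Bf (cstar_scale cB (-1) Bg).
by congr B; apply: funext => t; rewrite mulN1r.
Qed.

Lemma appB phi f g : B f -> B g ->
  app phi (fun t => f t - g t) = app phi f - app phi g.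
Proof.
move=> Bf Bg; rewrite -mulN1r -appZ // -appD //; last exact: cstar_scale.
by congr app; apply: funext => t; rewrite mulN1r.
Qed.

Lemma cstar_boundP f : B f -> exists2 M : R, 0 < M & forall t, `|f t| <= M%:X.
Proof.
move=> /(cstar_bounded cB)[M HM]; exists (`|M| + 1); first by rewrite ltr_wpDl.
move=> t; apply: (le_trans (HM t)); rewrite toCx_le.
by apply: (le_trans (ler_norm _)); rewrite lerDl.
Qed.

(* A character extends to multipliers of [B]; those it kills are the null ones.  Their
   sublevel sets form the filter of points close to the character. *)
Record null_multiplier (phi : spectrum B) (h : T -> R) : Prop := {
  null_ge0 : forall t, 0 <= h t;
  null_bounded : exists M, forall t, h t <= M;
  null_mul : forall k, B k -> B (fun t => (h t)%:X * k t);
  null_app : forall k, B k -> app phi (fun t => (h t)%:X * k t) = 0 }.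

Lemma null_multiplier0 phi : null_multiplier phi (fun=> 0).
Proof.
have E k : (fun t => (0 : R)%:X * k t) = (fun t : T => 0 * k t) by [].
split=> //; first by exists 0.
- by move=> k Bk; rewrite E; exact: cstar_scale.
- by move=> k Bk; rewrite E appZ // mul0r.
Qed.

Lemma null_multiplierD phi h1 h2 : null_multiplier phi h1 ->
  null_multiplier phi h2 -> null_multiplier phi (fun t => h1 t + h2 t).
Proof.
move=> [p1 [M1 b1] m1 a1] [p2 [M2 b2] m2 a2].
have E k : (fun t => (h1 t + h2 t)%:X * k t) =
           (fun t => (h1 t)%:X * k t + (h2 t)%:X * k t).
  by apply: funext => t; rewrite toCxD mulrDl.
split.
- by move=> t; rewrite addr_ge0.
- by exists (M1 + M2) => t; rewrite lerD.
- by move=> k Bk; rewrite E; apply: cstar_add => //; [exact: m1|exact: m2].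
- by move=> k Bk; rewrite E appD ?a1 ?a2 ?addr0 //; [exact: m1|exact: m2].
Qed.

(** With [l = app phi f], the squared distance is [(f - l)] times its conjugate. Multiplying [k] by
    the conjugate stays in [B], and [phi] kills whatever is then multiplied by [f - l]. The square
    keeps the multiplier polynomial in [f] and its conjugate. *)
Lemma null_multiplier_dist phi f : B f ->
  exists2 h, null_multiplier phi h &
    forall t, (h t)%:X = `|f t - app phi f| ^+ 2.
Proof.
move=> Bf; set l := app phi f.
have /choice[h hE] : forall t, exists r : R, r%:X = `|f t - l| ^+ 2.
  move=> t; have [r _ E] := Cx_norm_real (f t - l).
  by exists (r ^+ 2); rewrite toCxX E.
exists h => //.
have [M M0 HM] := cstar_boundP Bf.
have [L L0 HL] := Cx_norm_real l.
have Bk' k : B k -> B (fun t => (f t)^*%R * k t - l^*%R * k t).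
  move=> Bk; apply: cstar_sub; last exact: cstar_scale.
  by apply: cstar_mul => //; exact: cstar_conj.
have E k : (fun t => (h t)%:X * k t) =
  (fun t => f t * ((f t)^*%R * k t - l^*%R * k t) - l * ((f t)^*%R * k t - l^*%R * k t)).
  by apply: funext => t; rewrite hE normCK rmorphB /=; ring.
split.
- by move=> t; rewrite -toCx_le toCx0 hE exprn_ge0.
- exists ((M + L) ^+ 2) => t; rewrite -toCx_le hE toCxX toCxD lerXn2r ?nnegrE //.
    by rewrite -toCxD -toCx0 toCx_le addr_ge0 // ltW.
  by apply: (le_trans (ler_normB _ _)); rewrite lerD // HL.
- move=> k /Bk' Bk; rewrite E; apply: cstar_sub; last exact: cstar_scale.
  exact: cstar_mul.
- move=> k /Bk' Bk; rewrite E (appB phi (cstar_mul cB Bf Bk) (cstar_scale cB l Bk)).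
  by rewrite (appM phi Bf Bk) (appZ phi l Bk) subrr.
Qed.

(* If [h >= e], the geometric series of [1 - h / M] inverts [h] inside [B], so [phi = 0]. *)
Lemma null_multiplier_small phi h (e : R) : null_multiplier phi h -> 0 < e ->
  exists t, h t < e.
Proof.
move=> [h0 [M hM] hB hphi] e0; apply: contrapT => /forallNP H.
have {}H t : e <= h t by rewrite leNgt; apply/negP; exact: H.
pose N := Num.max M e.
have N0 : 0 < N by rewrite lt_max e0 orbT.
have hN t : h t <= N by rewrite le_max hM.
have eN : e <= N by rewrite le_max lexx orbT.
have [f Bf f0] := app_neq0 phi.
pose u t := 1 - h t / N; pose q := 1 - e / N.
have u0 t : 0 <= u t by rewrite subr_ge0 ler_pdivrMr // mul1r.
have uq t : u t <= q by rewrite lerD2l lerN2 ler_pM2r ?invr_gt0.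
have q0 : 0 <= q by rewrite subr_ge0 ler_pdivrMr // mul1r.
have q1 : q < 1 by rewrite ltrBlDr ltrDl divr_gt0.
have hX t : (h t)%:X != 0.
  by rewrite -toCx0 (inj_eq (@toCx_inj R)) gt_eqF // (lt_le_trans e0).
have NX : N%:X != 0 by rewrite -toCx0 (inj_eq (@toCx_inj R)) gt_eqF.
pose g t := N%:X * f t / (h t)%:X.
have uE k : (fun t => (u t)%:X * k t) = (fun t => k t - (N%:X)^-1 * ((h t)%:X * k t)).
  by apply: funext => t; rewrite /u toCxD toCxN toCxM toCxV toCx1; ring.
have uB k : B k -> B (fun t => (u t)%:X * k t).
  by move=> Bk; rewrite uE; apply: cstar_sub => //; apply: cstar_scale => //; exact: hB.
have gE : g = (fun t => f t + (u t)%:X * g t).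
  apply: funext => t; rewrite /g /u toCxD toCxN toCxM toCxV toCx1.
  by field; rewrite hX NX.
pose S := fix S n := if n is n'.+1 then (fun t => f t + (u t)%:X * S n' t) else (fun=> 0 : C).
have SB n : B (S n).
  elim: n => [|n IH] /=; first exact: cstar_0.
  by apply: cstar_add => //; exact: uB.
have [K K0 fK] := cstar_boundP Bf.
pose G := N * K / e.
have G0 : 0 < G by rewrite !mulr_gt0 ?invr_gt0.
have gG t : `|g t| <= G%:X.
  rewrite /g /G !normrM normfV !toCx_norm !toCxM (gtr0_norm N0) (ger0_norm (h0 t)) !toCxV.
  rewrite ler_pM ?invr_ge0 ?mulr_ge0 //.
  - by rewrite -toCx0 toCx_le ltW.
  - by rewrite -toCx0 toCx_le.
  - by rewrite ler_pM2l // -toCx0 toCx_lt.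
  - by rewrite lef_pV2 ?posrE ?toCx_le // -toCx0 toCx_lt // (lt_le_trans e0).
have Sg n t : `|g t - S n t| <= (q ^+ n * G)%:X.
  elim: n => [|n IH] /=; first by rewrite subr0 expr0 mul1r.
  rewrite [g t](congr1 (fun k => k t) gE) opprD addrACA subrr add0r -mulrBr.
  rewrite normrM exprS -mulrA toCxM ler_pM //.
  by rewrite toCx_norm ger0_norm // toCx_le.
have Bg : B g.
  apply: (cstar_closed cB) => d d0.
  have qn : (fun n => q ^+ n) @ \oo --> (0 : R).
    by apply: cvg_expr; rewrite ger0_norm.
  have /cvgrPdist_lt/(_ (d / G)) := qn; rewrite divr_gt0 // => /(_ isT)[n _ nP].
  exists (S n) => // t; apply: (le_trans (Sg n t)); rewrite toCx_le.
  have := nP n (leqnn n); rewrite sub0r normrN ger0_norm ?exprn_ge0 //.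
  by rewrite ltr_pdivlMr // => /ltW.
(* [g = N * f / h] solves [g = f + u * g] with [u = 1 - h / N]. Since [phi] kills [h * g], it takes
   the same value on [u * g] as on [g], which forces [app phi f = 0]. *)
have : app phi g = app phi g + app phi f.
  rewrite {1}gE (appD phi Bf (uB g Bg)) uE.
  rewrite (appB phi Bg (cstar_scale cB _ (hB g Bg))) (appZ phi _ (hB g Bg)).
  by rewrite hphi // mulr0 subr0 addrC.
by move/eqP; rewrite -subr_eq0 opprD addrA subrr sub0r oppr_eq0 (negbTE f0).
Qed.

Definition near_filter (phi : spectrum B) : set_system T :=
  filter_from [set p : (T -> R) * R | null_multiplier phi p.1 /\ 0 < p.2]
    (fun p => [set t | p.1 t < p.2]).

Global Instance near_filter_proper phi : ProperFilter (near_filter phi).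
Proof.
apply: filter_from_proper; last first.
  by move=> [h e] [/= hh e0]; exact: null_multiplier_small hh e0.
apply: filter_from_filter.
  by exists ((fun=> 0), 1) => /=; split => //; exact: null_multiplier0.
move=> [h1 e1] [h2 e2] [/= H1 e10] [/= H2 e20].
exists ((fun t => h1 t + h2 t), Num.min e1 e2) => /=.
  by split; [exact: null_multiplierD|rewrite lt_min e10].
move=> t /=; rewrite lt_min => /andP[le1 le2]; split.
  by apply: le_lt_trans le1; rewrite lerDl (null_ge0 H2).
by apply: le_lt_trans le2; rewrite lerDr (null_ge0 H1).
Qed.

Lemma tends_near phi : tends (near_filter phi) id phi.
Proof.
move=> f Bf; apply/cvgCxP => e e0.
have [h hn hE] := null_multiplier_dist phi Bf.
exists (h, e ^+ 2); first by split=> //=; rewrite exprn_gt0.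
move=> t /=; rewrite -toCx_lt hE toCxX ltr_pXn2r ?nnegrE //.
by rewrite -toCx0 toCx_le ltW.
Qed.

(** [near_filter phi] is the coarsest filter converging to [phi]. A null multiplier [h] need not lie
    in [B], so its limit is read off the quotient of [h * f] by [f], where [phi] does not vanish on
    [f]. *)
Lemma tends_filter (I : Type) (F : set_system I) (k : I -> T) phi : Filter F ->
  tends F k phi -> k @ F --> near_filter phi.
Proof.
move=> FF kphi P [[h e] [/= hh e0] hP].
have [f Bf f0] := app_neq0 phi.
have c1 : (fun i => f (k i)) @ F --> app phi f := kphi _ Bf.
have c2 := kphi _ (null_mul hh Bf).
rewrite (null_app hh Bf) in c2.
have c3 : (fun i => (h (k i))%:X) @ F --> (0 : C).
  have c4 : (fun i => (h (k i))%:X * f (k i) / f (k i)) @ F --> 0 / app phi f.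
    by apply: cvgM; [exact: c2|apply: cvgV; [exact: f0|exact: c1]].
  rewrite mul0r in c4; apply: cvg_trans c4; apply: near_eq_cvg.
  have : \forall i \near F, f (k i) != 0 by apply: (cvgr_neq0 _ c1).
  by apply: filterS => i fi; rewrite mulfK.
move: c3 => /cvgCxP/(_ e e0); apply: filterS => i; rewrite subr0 toCx_norm toCx_lt.
by rewrite ger0_norm ?(null_ge0 hh) // => ?; exact: hP.
Qed.

End Spectrum.

(** An operation need only be defined on the canonical filter of [phi]: every other filter
    converging to [phi] is finer, so the same limit is found along it. *)
Lemma tends_comp (R : realType) (T T' I : Type) (B : set (T -> Cx R))
    (B' : set (T' -> Cx R)) (F : set_system I) (k : I -> T) (k' : T -> T')
    (phi : spectrum B) (psi : spectrum B') :
  Filter F -> tends F k phi ->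
  tends (near_filter phi) k' psi -> tends F (k' \o k) psi.
Proof.
move=> FF h1 h2 f Bf.
move=> P nP; have FP : near_filter phi ((f \o k') @^-1` P) := h2 f Bf P nP.
have H := @tends_filter R T B I F k phi FF h1.
by have := H _ FP.
Qed.

(** * Topology of the spectrum *)

Lemma cvg_initial (S : choiceType) (T : topologicalType) (f : S -> T)
    (F : set_system S) {FF : Filter F} (x : initial_topology f) :
  f @ F --> f x -> F --> x.
Proof.
move=> fF N; rewrite nbhsE; case=> W [[V oV <-] Vx] VN.
by apply: filterS VN _; apply: fF; apply: open_nbhs_nbhs.
Qed.

Lemma cvg_prod_topology (I : Type) (T : I -> topologicalType)
    (F : set_system (prod_topology T)) {FF : Filter F} (x : prod_topology T) :
  (forall i, (fun y : prod_topology T => y i) @ F --> x i) -> F --> x.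
Proof.
move=> H; apply/cvg_sup => i.
exact: (@cvg_initial _ _ (fun y : prod_topology T => y i) F _ x).
Qed.

Lemma cvg_set_type (T : topologicalType) (A : set T) (F : set_system A)
    {FF : Filter F} (x : A) :
  set_val @ F --> set_val x -> F --> x.
Proof. by move=> H; exact: (@cvg_initial A T set_val). Qed.

Lemma cvg_prod_proj (I : Type) (T : I -> topologicalType) (i : I) :
  continuous (fun y : prod_topology T => y i).
Proof.
move=> y; have /cvg_sup/(_ i) H : y --> y by apply: cvg_id.
apply: cvg_trans (@initial_continuous _ _ (fun z : (forall i, T i) => z i) y).
exact: cvg_app H.
Qed.

(** * Limits of bounded complex functions along ultrafilters *)

Section ComplexCompact.
Variable R : realType.
Local Notation C := (Cx R).

Lemma toCx_continuous : continuous (fun x : R => x%:X).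
Proof.
move=> x; apply/cvgCxP => e e0.
apply: filterS (nbhsx_ballx x e e0) => y.
by rewrite -toCxN -toCxD toCx_norm toCx_lt distrC.
Qed.

Lemma Cx_disc_sub_compact (M : R) : exists2 K : set C, compact K &
  [set z : C | `|z| <= M%:X] `<=` K.
Proof.
pose f (p : R * R) : C := p.1%:X + 'i%C * p.2%:X.
exists (f @` (`[- M, M] `*` `[- M, M])).
  apply: continuous_compact; last by apply: compact_setX; exact: segment_compact.
  apply: continuous_subspaceT => p; apply: cvgD.
    apply: (@continuous_comp _ _ _ fst (fun x : R => x%:X)); [exact: cvg_fst|exact: toCx_continuous].
  apply: cvgMr.
  apply: (@continuous_comp _ _ _ snd (fun x : R => x%:X)); [exact: cvg_snd|exact: toCx_continuous].
move=> z /= zM; exists (complex.Re z, complex.Im z); last first.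
  by rewrite /f /=; case: z {zM} => a b; simpc.
have hr : `|complex.Re z| <= M.
  rewrite -toCx_le; apply: le_trans zM; exact: normc_ge_Re.
have hi : `|complex.Im z| <= M.
  rewrite -toCx_le; apply: le_trans zM.
  have i1 : `|'i%C : C| = 1 by rewrite normc_def /= expr0n add0r expr1n sqrtr1.
  have -> : `|z| = `|'i%C * z| by rewrite normrM i1 mul1r.
  apply: le_trans (normc_ge_Re _).
  by case: (z) => a b; simpc; rewrite /= normrN.
by rewrite /= !in_itv /= -!ler_norml.
Qed.

Lemma Cx_bounded_ultra (I : Type) (F : set_system I) (f : I -> C) (M : R) :
  UltraFilter F -> (forall i, `|f i| <= M%:X) -> exists l : C, f @ F --> l.
Proof.
move=> FU fM; have [K cK MK] := Cx_disc_sub_compact M.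
have FP : ProperFilter F by exact: ultra_proper.
have FK : F (f @^-1` K) by apply: filterE => i; exact: (MK (f i) (fM i)).
have [l [_ cl]] := cK _ (fmap_proper_filter f FP) FK.
exists l => N Nl.
have [//|FN] := in_ultra_setVsetC (f @^-1` N) FU.
by have [z [/= nz Nz]] := cl (~` N) N FN Nl.
Qed.

End ComplexCompact.

Section SpectrumTopology.
Variables (R : realType) (T : Type) (B : set (T -> Cx R)).
Hypothesis cB : cstar_subalgebra B.
Local Notation C := (Cx R).

Lemma cvg_spectrum (I : Type) (F : set_system I) {FF : Filter F}
    (theta : I -> spectrum B) (phi : spectrum B) :
  (forall f, B f -> (fun i => app (theta i) f) @ F --> app phi f) ->
  theta @ F --> phi.
Proof.
move=> H.
apply: cvg_set_type; apply: cvg_prod_topology => f.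
have := H (set_val f) (set_valP f); rewrite -appE.
by under eq_fun do rewrite -appE.
Qed.

Lemma app_continuous (f : T -> C) : B f ->
  continuous (fun phi : spectrum B => app phi f).
Proof.
move=> Bf.
have -> : (fun phi : spectrum B => app phi f) =
    (fun phi => spectrum_app phi (exist _ f (mem_set Bf))).
  by apply: funext => phi; rewrite app_val.
move=> phi; apply: (@continuous_comp _ _ _ (set_val : spectrum B -> _) (fun y : prod_topology _ => y _)).
  exact: initial_continuous.
exact: cvg_prod_proj.
Qed.

Lemma spectrum_continuousP (U : topologicalType) (theta : U -> spectrum B) :
  (forall f, B f -> continuous (fun u => app (theta u) f)) -> continuous theta.
Proof. by move=> H u; apply: cvg_spectrum => f Bf; exact: H. Qed.

Lemma spectrum_hausdorff : hausdorff_space (spectrum B).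
Proof.
move=> phi psi; rewrite cluster_cvgE => -[G GP [Gpsi Gphi]].
apply: spectrum_eq => f Bf.
apply: (@Cx_cvg_unique R _ G (fun chi => app chi f)).
  apply: cvg_trans (app_continuous Bf (x := phi)); exact: cvg_app.
apply: cvg_trans (app_continuous Bf (x := psi)); exact: cvg_app.
Qed.

(** Characters are contractive because [app phi f] is a limit of values of [f] along
    [near_filter phi]. *)
Lemma app_norm_le (phi : spectrum B) f (M : R) : B f -> (forall t, `|f t| <= M%:X) ->
  `|app phi f| <= M%:X.
Proof.
move=> Bf fM; have [r r0 E] := Cx_norm_real (app phi f).
rewrite E toCx_le leNgt; apply/negP => Mr.
have /cvgCxP/(_ (r - M)) := @tends_near _ _ _ cB phi _ Bf.
rewrite subr_gt0 => /(_ Mr) /filter_ex[t /=]; apply/negP; rewrite -real_leNgt ?normr_real ?toCx_real //.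
rewrite distrC toCxD toCxN -E lerBlDr -lerBlDl.
apply: (le_trans (lerB_dist _ _)); rewrite opprB addrCA subrr addr0; exact: fM.
Qed.

(** Pointwise limits along an ultrafilter exist by contractivity, but in a non-unital algebra they
    may all vanish; the condition [app phi f = 1] survives in the limit and prevents this. *)
Lemma spectrum_ultra (U : set_system (spectrum B)) (f : T -> C) : UltraFilter U ->
  B f -> U [set phi | app phi f = 1] -> exists phi, app phi f = 1 /\ U --> phi.
Proof.
move=> UU Bf Uf; have UP : ProperFilter U by exact: ultra_proper.
have f1 : (fun phi => app phi f) @ U --> (1 : C).
  apply: cvg_near_cst; by apply: filterS Uf => phi /= ->.
have [|||||phi phiP] := @lim_character _ _ B _ U (fun phi f => app phi f).
- by move=> phi g h; exact: appD.
- by move=> phi c g; exact: appZ.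
- by move=> phi g h; exact: appM.
- move=> g Bg; have [M M0 gM] := cstar_boundP cB Bg.
  by apply: Cx_bounded_ultra => phi; exact: app_norm_le gM.
- by exists f, 1; split=> //; exact: oner_neq0.
exists phi; split; first exact: Cx_cvg_unique _ (phiP f Bf) f1.
exact: (@cvg_spectrum _ U _ id).
Qed.

Lemma spectrum_compact (f : T -> C) : B f -> compact [set phi : spectrum B | app phi f = 1].
Proof.
move=> Bf; rewrite compact_ultra => U UU Uf.
by have [phi [? ?]] := spectrum_ultra UU Bf Uf; exists phi.
Qed.

Lemma is_evaluationP t (phi : spectrum B) :
  is_evaluation t phi <-> forall f, B f -> app phi f = f t.
Proof.
split=> H f; first by move=> Bf; rewrite (app_val _ Bf) H.
by rewrite appE H //; exact: set_valP.
Qed.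

(** An evaluation is the limit of a constant map along the filter of a one-point type, so all
    results on [tends] apply to evaluations. Some function must not vanish at [t], as the zero
    functional is not a character. *)
Lemma evaluation_exists t : (exists2 f, B f & f t != 0) ->
  exists phi : spectrum B, is_evaluation t phi.
Proof.
move=> [f Bf f0].
have FF : ProperFilter (principal_filter tt) := @ultra_proper _ _ (principal_filter_ultra tt).
have [||phi phiP] := @tends_exists _ _ B unit (principal_filter tt) (fun=> t).
- by move=> g Bg; exists (g t); exact: cvg_cst.
- by exists f, (f t); split => //; exact: cvg_cst.
exists phi; apply/is_evaluationP => g Bg.
by apply: Cx_cvg_unique _ (phiP g Bg) _; exact: cvg_cst.
Qed.

Lemma is_evaluation_tends (I : Type) (F : set_system I) t (phi : spectrum B) :
  Filter F -> is_evaluation t phi -> tends F (fun=> t) phi.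
Proof.
move=> FF /is_evaluationP H f Bf; rewrite H //; exact: cvg_cst.
Qed.

Lemma tends_is_evaluation (I : Type) (F : set_system I) t (phi : spectrum B) :
  ProperFilter F -> tends F (fun=> t) phi -> is_evaluation t phi.
Proof.
move=> FF H; apply/is_evaluationP => f Bf.
apply: Cx_cvg_unique _ (H f Bf) _; exact: cvg_cst.
Qed.

Lemma is_evaluation_unique t (phi psi : spectrum B) :
  is_evaluation t phi -> is_evaluation t psi -> phi = psi.
Proof.
move=> /is_evaluationP h1 /is_evaluationP h2.
by apply: spectrum_eq => f Bf; rewrite h1 // h2.
Qed.

End SpectrumTopology.

(** * The topology of the Renault-Deaconu groupoid *)

(** Compactness as an induction principle. If [P K] failed, the sets containing [K] minus some set
    with [P] would form a proper filter on [K], and a cluster point of it would contradict the local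
    hypothesis. *)
Lemma compact_ind (T : topologicalType) (K : set T) (P : set T -> Prop) :
  compact K -> P set0 ->
  (forall A B, P A -> P B -> P (A `|` B)) ->
  (forall A B, A `<=` B -> P B -> P A) ->
  (forall x, K x -> exists2 N, nbhs x N & P N) -> P K.
Proof.
move=> cK P0 PU PS PN; apply: contrapT => nPK.
pose F := [set A | exists2 N, P N & K `\` N `<=` A].
have FF : Filter F.
  split.
  - by exists set0.
  - move=> A B [M PM MA] [N PN' NB]; exists (M `|` N); first exact: PU.
    by move=> x [Kx /not_orP[nM nN]]; split; [exact: MA|exact: NB].
  - by move=> A B AB [N PN' NA]; exists N => // x /NA /AB.
have FP : ProperFilter F.
  apply: Build_ProperFilter_ex => A [N PN' NA]; apply: contrapT => A0.
  apply: nPK; apply: PS PN' => x Kx; apply: contrapT => Nx.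
  by apply: A0; exists x; exact: NA.
have [|x [Kx clx]] := cK F FP.
  by exists set0 => // x [].
have [N Nx PN'] := PN x Kx.
have FKN : F (K `\` N) by exists N.
have [y [[_ nNy] Ny]] := clx (K `\` N) N FKN Nx.
exact: nNy.
Qed.

Lemma ultra_bits (I : Type) (F : set_system I) (b : I -> nat -> bool) :
  UltraFilter F -> exists c : nat -> bool,
    forall n, F [set i | forall j, (j < n)%N -> b i j = c j].
Proof.
move=> FU; have FP : ProperFilter F by exact: ultra_proper.
have /choice[c cP] : forall n, exists c, F [set i | b i n = c].
  move=> n; have [H|H] := in_ultra_setVsetC [set i | b i n] FU.
    by exists true.
  by exists false; apply: filterS H => i /= /negP/negbTE.
exists c; elim=> [|n IH]; first by apply: filterE.
apply: filterS (filterI IH (cP n)) => i [/= H1 H2] j.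
by rewrite ltnS leq_eqVlt => /predU1P[->|/H1].
Qed.

Section OrderedPrimeShift.

Lemma Z_extend (g : GX) (N : nat) : exists u v, Z u v g /\ (N <= size u)%N.
Proof.
have [m [n [dg E]]] := gxP g.
exists (mkseq (letters (grange g)) (N + m)), (mkseq (letters (gsource g)) (N + n)).
split; last by rewrite size_mkseq leq_addr.
split; rewrite /begins_with ?size_mkseq //; first by rewrite dg; lia.
by rewrite !iterD E.
Qed.

Lemma Z_language u v g : Z u v g -> in_language u /\ in_language v.
Proof.
by case=> bu bv _ _; split; [exists (grange g)|exists (gsource g)]; exists 0%N.
Qed.

Lemma nbhs_Z u v g : Z u v g -> nbhs g (Z u v).
Proof.
move=> zg; rewrite nbhsE; exists (Z u v) => //; split=> //.
exists [set (u, v)]; first by move=> _ /= ->; exact: Z_language zg.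
by rewrite bigcup_set1.
Qed.

Lemma nbhs_GX g (N : set GX) : nbhs g N ->
  exists u v, Z u v g /\ Z u v `<=` N.
Proof.
rewrite nbhsE; case=> W [[D _ <-] [[u v] Duv /= zg]] WN.
by exists u, v; split => // h zh; apply: WN; exists (u, v).
Qed.

Lemma cvg_GX (F : set_system GX) {FF : Filter F} g :
  (forall u v, Z u v g -> F (Z u v)) -> F --> g.
Proof.
move=> H N /nbhs_GX[u [v [zg ZN]]].
by apply: filterS ZN _; exact: H.
Qed.

Lemma Z_open u v : open (Z u v).
Proof. by rewrite openE => g zg; exact: nbhs_Z. Qed.

(** Cylinders that meet are nested according to the lengths of their words, so a cylinder around a
    limit point with a first word at least as long as [u] lies inside [Z u v]. *)
Lemma Z_closed u v : closed (Z u v).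
Proof.
move=> g cg; have [u' [v' [zg le]]] := Z_extend g (size u).
have [h [zh zh']] := cg _ (nbhs_Z zg).
exact: (Z_sub zh zh' le).
Qed.

Lemma Z_grange u v g i : Z u v g -> letters (grange g) i =
  if (i < size u)%N then nth false u i
  else letters (gsource g) (size v + (i - size u)).
Proof.
case=> /begins_withP bu _ _ E; case: ifPn => iu; first exact: bu.
rewrite -letters_iter_shift -E letters_iter_shift; congr letters; lia.
Qed.

Lemma Z_src_inj u v g h : Z u v g -> Z u v h -> gsource g = gsource h -> g = h.
Proof.
move=> zg zh s; apply: GX_eq => //; last by case: zg zh => _ _ -> _ [_ _ ->].
apply: letters_inj; apply: funext => i.
by rewrite (Z_grange _ zg) (Z_grange _ zh) s.
Qed.

Lemma Z_inv u v g : Z u v g -> Z v u (GX_inv g).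
Proof. by case=> bu bv d E; split => //=; rewrite d opprB. Qed.

Lemma GX_invK : involutive GX_inv.
Proof. by move=> g; apply: GX_eq => //=; rewrite opprK. Qed.

Lemma Z_invE u v g : Z u v (GX_inv g) <-> Z v u g.
Proof. by split=> /Z_inv; rewrite ?GX_invK. Qed.

Lemma Z_rng_inj u v g h : Z u v g -> Z u v h -> grange g = grange h -> g = h.
Proof.
move=> /Z_inv zg /Z_inv zh r; apply: (inv_inj GX_invK).
exact: Z_src_inj zg zh r.
Qed.

Lemma Z_separate g h : g <> h -> exists u v, Z u v g /\ ~ Z u v h.
Proof.
move=> gh; apply: contrapT => H; apply: gh.
have {}H u v : Z u v g -> Z u v h.
  by move=> zg; apply: contrapT => zh; apply: H; exists u, v.
apply: GX_eq.
- apply: letters_inj; apply: funext => i.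
  have [u [v [zg iu]]] := Z_extend g i.+1.
  by rewrite (Z_grange _ zg) (Z_grange _ (H _ _ zg)) iu.
- have [u [v [zg _]]] := Z_extend g 0.
  by have [_ _ -> _] := zg; have [_ _ -> _] := H _ _ zg.
- apply: letters_inj; apply: funext => i.
  have [u [v [/Z_inv zg iu]]] := Z_extend (GX_inv g) i.+1.
  rewrite GX_invK in zg; have /Z_inv zh := H _ _ zg; move/Z_inv: zg => zg.
  by have /= -> := Z_grange i zg; have /= -> := Z_grange i zh; rewrite iu.
Qed.

Lemma GX_hausdorff : hausdorff_space GX.
Proof.
move=> g h cgh; apply: contrapT => /Z_separate[u [v [zg zh]]].
have [k [zk nzk]] := cgh (Z u v) (~` Z u v) (nbhs_Z zg)
  (open_nbhs_nbhs (conj (closed_openC (@Z_closed u v)) zh)).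
exact: nzk.
Qed.

Lemma GX_mulE g h : gsource g = grange h ->
  [/\ grange (GX_mul g h) = grange g, gdeg (GX_mul g h) = gdeg g + gdeg h &
      gsource (GX_mul g h) = gsource h].
Proof. by move=> e; rewrite /GX_mul; case: pselect. Qed.

Lemma GX_is_groupoid : is_groupoid GX_groupoid.
Proof.
split=> //=.
- by move=> g h /GX_mulE[].
- by move=> g h /GX_mulE[].
- move=> g h k gh hk.
  have [r1 d1 s1] := GX_mulE gh; have [r2 d2 s2] := GX_mulE hk.
  have [r3 d3 s3] := @GX_mulE (GX_mul g h) k (etrans s1 hk).
  have [r4 d4 s4] := @GX_mulE g (GX_mul h k) (etrans gh (esym r2)).
  by apply: GX_eq; rewrite ?r3 ?r4 ?d3 ?d4 ?s3 ?s4 ?r1 ?d1 ?d2 ?s2 ?addrA.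
- move=> g; have [r d s] := @GX_mulE (GX_unit (grange g)) g erefl.
  by apply: GX_eq; rewrite ?r ?d ?s //= add0r.
- move=> g; have [r d s] := @GX_mulE g (GX_unit (gsource g)) erefl.
  by apply: GX_eq; rewrite ?r ?d ?s //= addr0.
- move=> g; have [r d s] := @GX_mulE (GX_inv g) g erefl.
  by apply: GX_eq; rewrite ?r ?d ?s //= addNr.
- move=> g; have [r d s] := @GX_mulE g (GX_inv g) erefl.
  by apply: GX_eq; rewrite ?r ?d ?s //= addrN.
Qed.

(** If [v] is the shorter middle word, [u] is prolonged by what [v'] has beyond [v]; the other case
    follows by inversion. The lower bound on [size u''] is what allows nesting through [Z_sub] in
    [GX_mul_continuous]. *)
Lemma Z_mul u v v' w : exists u'' w'', (size u <= size u'')%N /\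
  forall g h, Z u v g -> Z v' w h -> gsource g = grange h -> Z u'' w'' (GX_mul g h).
Proof.
have H u1 v1 v2 w1 : (size v1 <= size v2)%N -> forall g h, Z u1 v1 g ->
    Z v2 w1 h -> gsource g = grange h ->
    Z (u1 ++ drop (size v1) v2) w1 (GX_mul g h).
  move=> le g h zg zh gh; have [r d s] := GX_mulE gh.
  have [/begins_withP bu /begins_withP bv dg Eg] := zg.
  have [/begins_withP bu' /begins_withP bv' dh Eh] := zh.
  have sz : size (u1 ++ drop (size v1) v2) = (size u1 + (size v2 - size v1))%N.
    by rewrite size_cat size_drop.
  split; rewrite ?r ?d ?s ?sz.
  - apply/begins_withP => j; rewrite sz nth_cat => ju; case: ifPn => ju1.
      exact: bu.
    have -> : j = (size u1 + (j - size u1))%N by lia.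
    rewrite -letters_iter_shift Eg letters_iter_shift gh bu'; last by lia.
    by rewrite nth_drop; congr nth; lia.
  - exact/begins_withP.
  - by rewrite dg dh; lia.
  - rewrite addnC iterD Eg -iterD subnK // gh; exact: Eh.
have [le|/ltnW le] := leqP (size v) (size v').
  exists (u ++ drop (size v) v'), w; split; first by rewrite size_cat leq_addr.
  exact: H.
exists u, (w ++ drop (size v') v); split => // g h zg zh gh.
have := H w v' v u le (GX_inv h) (GX_inv g) (Z_inv zh) (Z_inv zg) (esym gh).
move/Z_inv; congr Z.
have [r d s] := GX_mulE gh.
have [r' d' s'] := @GX_mulE (GX_inv h) (GX_inv g) (esym gh).
by apply: GX_eq; rewrite /= ?r ?d ?s ?r' ?d' ?s' //=; lia.
Qed.

(** A cylinder around [g] with a long first word makes the cylinder of the products long enough to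
    be nested in [Z u v], which it meets at the product of [g] and [h]. *)
Lemma GX_mul_continuous g h u v : gsource g = grange h -> Z u v (GX_mul g h) ->
  exists u1 v1 u2 v2, [/\ Z u1 v1 g, Z u2 v2 h &
    forall g' h', Z u1 v1 g' -> Z u2 v2 h' -> gsource g' = grange h' ->
      Z u v (GX_mul g' h')].
Proof.
move=> gh zgh; have [u1 [v1 [zg le]]] := Z_extend g (size u).
have [u2 [v2 [zh _]]] := Z_extend h 0.
exists u1, v1, u2, v2; split => // g' h' zg' zh' gh'.
have [u3 [v3 [le3 H]]] := Z_mul u1 v1 u2 v2.
apply: (Z_sub zgh (H _ _ zg zh gh) (leq_trans le le3)).
exact: H.
Qed.

Lemma Z_unit g : Z [::] [::] g <-> g = GX_unit (grange g).
Proof.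
split=> [[_ _ d E]|->]; last by split.
by apply: GX_eq.
Qed.

Lemma Z_unitP u v x : Z u v (GX_unit x) <-> u = v /\ begins_with u (letters x).
Proof.
split=> [[bu bv /= d E]|[<- bu]]; last by split; rewrite //= subrr.
split=> //; rewrite -bu -bv; congr mkseq; lia.
Qed.

(** The limit along an ultrafilter is formed letter by letter on both sides. Avoiding a forbidden
    word, having a given prefix and each coordinate of the tail equation involve finitely many
    letters, hence pass to the limit; the exponents are fixed by [u] and [v]. *)
Lemma Z_compact u v : compact (Z u v).
Proof.
rewrite compact_ultra => F FU FZ.
have FP : ProperFilter F by exact: ultra_proper.
have [c cP] := ultra_bits (fun g => letters (grange g)) FU.
have [d dP] := ultra_bits (fun g => letters (gsource g)) FU.
have shiftP (b : GX -> X) (e : nat -> bool) :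
    (forall n, F [set g | forall j, (j < n)%N -> letters (b g) j = e j]) -> ops_set e.
  move=> H w Fw [i Ew].
  have [g /= gP] := filter_ex (H (i + size w)%N).
  apply: (set_mem (valP (b g)) w Fw); exists i; rewrite -[RHS]Ew.
  apply/eq_in_map => j; rewrite mem_iota => /andP[_ jw].
  apply: gP; lia.
pose x : X := exist _ c (mem_set (shiftP _ _ cP)).
pose y : X := exist _ d (mem_set (shiftP _ _ dP)).
have xE : letters x = c by [].
have yE : letters y = d by [].
have bu : begins_with u (letters x).
  have [g [/= [/begins_withP bu _ _ _] gP]] := filter_ex (filterI FZ (cP (size u))).
  by apply/begins_withP => j ju; rewrite xE -gP // bu.
have bv : begins_with v (letters y).
  have [g [/= [_ /begins_withP bv _ _] gP]] := filter_ex (filterI FZ (dP (size v))).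
  by apply/begins_withP => j ju; rewrite yE -gP // bv.
have E : iter (size u) shift x = iter (size v) shift y.
  apply: letters_inj; apply: funext => i; rewrite !letters_iter_shift xE yE.
  have [g [[/= [_ _ _ Eg] gP] gP']] :=
    filter_ex (filterI (filterI FZ (cP (size u + i).+1)) (dP (size v + i).+1)).
  by rewrite -gP // -gP' // -!letters_iter_shift Eg.
have gx : exists m n : nat, (size u)%:Z - (size v)%:Z = m%:Z - n%:Z /\
    iter m shift x = iter n shift y by exists (size u), (size v).
pose g := MkGX gx.
have zg : Z u v g by split.
exists g; split=> //=; apply: cvg_GX => u' v' zg'.
apply: filterS (filterI (filterI FZ (cP (size u + size u')%N)) (dP (size v + size v')%N)).
move=> h [[/= zh hP] hP'].
have [u1 [v1 [zh1 le1]]] := Z_extend h (size u).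
have [/begins_withP hu /begins_withP hv dh Eh] := zh.
have [/begins_withP gu /begins_withP gv dg Eg] := zg'.
split.
- apply/begins_withP => j ju; rewrite hP; last by lia.
  exact: gu.
- apply/begins_withP => j ju; rewrite hP'; last by lia.
  exact: gv.
- by rewrite dh -dg.
(* Both pairs of words have the same difference of lengths, so the positions [size u' + i] and
   [size v' + i] leave [u] and [v] together. Before that, the letters of [h] agree with those of the
   limit; afterwards the tail equation for [u] and [v] applies. *)
have duv : (size u + size v' = size v + size u')%N by move: dg => /=; lia.
apply: letters_inj; apply: funext => i; rewrite !letters_iter_shift.
have [iu|iu] := ltnP (size u' + i) (size u).
  rewrite hP ?hP'; [|lia|lia].
  by rewrite -xE -yE -!letters_iter_shift Eg.
have -> : (size u' + i = size u + (size u' + i - size u))%N by lia.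
have -> : (size v' + i = size v + (size u' + i - size u))%N by lia.
by rewrite -!letters_iter_shift Eh.
Qed.

Lemma letters_continuous j : continuous (fun x : X => letters x j).
Proof.
move=> x; apply: (@continuous_comp _ _ _ (set_val : X -> _) (fun y : cantor_space => y j)).
  exact: initial_continuous.
exact: cvg_prod_proj.
Qed.

Lemma nbhs_letters (x : X) n :
  nbhs x [set y | forall j, (j < n)%N -> letters y j = letters x j].
Proof.
elim: n => [|n IH]; first by apply: filterE.
have H : nbhs x [set y | letters y n = letters x n].
  apply: (@letters_continuous n x [set b | b = letters x n]).
  by apply: open_nbhs_nbhs; split=> //; exact: discrete_open.
apply: filterS (filterI IH H) => y [/= H1 H2] j.
by rewrite ltnS leq_eqVlt => /predU1P[->|/H1].
Qed.

Lemma gsource_continuous : continuous gsource.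
Proof.
move=> g; have FF : Filter (nbhs g) by exact: nbhs_filter.
have FF1 : Filter (gsource @ nbhs g) by exact: fmap_filter.
have FF2 : Filter (set_val @ (gsource @ nbhs g)) by exact: fmap_filter.
apply: (@cvg_set_type _ _ (gsource @ nbhs g) FF1).
apply: (@cvg_prod_topology nat (fun=> bool) _ FF2) => j N Nj.
have [u [v [/Z_inv zg le]]] := Z_extend (GX_inv g) j.+1; rewrite GX_invK in zg.
apply: filterS (nbhs_Z zg) => h zh.
have [_ /begins_withP bg _ _] := zg; have [_ /begins_withP bh _ _] := zh.
rewrite /= -[set_val _]/(letters (gsource h)) bh // -bg //.
exact: nbhs_singleton Nj.
Qed.

Lemma GX_unit_continuous : continuous GX_unit.
Proof.
move=> x; have FF : Filter (nbhs x) by exact: nbhs_filter.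
have FF1 : Filter (GX_unit @ nbhs x) by exact: fmap_filter.
apply: (@cvg_GX _ FF1) => u v /Z_unitP[<- /begins_withP bu].
apply: filterS (nbhs_letters x (size u)) => y yP /=.
by apply/Z_unitP; split=> //; apply/begins_withP => j ju; rewrite yP // bu.
Qed.

Lemma GX_inv_continuous : continuous GX_inv.
Proof.
move=> g; have FF : Filter (nbhs g) by exact: nbhs_filter.
have FF1 : Filter (GX_inv @ nbhs g) by exact: fmap_filter.
apply: (@cvg_GX _ FF1) => u v /Z_invE zg.
by apply: filterS (nbhs_Z zg) => h /Z_inv.
Qed.

Lemma X_compact : compact [set: X].
Proof.
have -> : [set: X] = gsource @` Z [::] [::].
  apply/seteqP; split=> // x _; exists (GX_unit x); [exact/Z_unit|by []].
apply: continuous_compact; last exact: Z_compact.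
exact/continuous_subspaceT/gsource_continuous.
Qed.

End OrderedPrimeShift.

(** * The algebras D and A *)

Definition bounded_functions (R : realType) (T : Type) : set (T -> Cx R) :=
  [set f | exists M : R, forall t, `|f t| <= M%:X].

Definition indC (R : realType) (T : Type) (A : set T) (t : T) : Cx R :=
  if `[< A t >] then 1 else 0.

Section BoundedFunctions.
Variable R : realType.
Local Notation C := (Cx R).

Lemma indC1 (T : Type) (A : set T) t : A t -> indC R A t = 1.
Proof. by move=> At; rewrite /indC asboolT. Qed.

Lemma indC0 (T : Type) (A : set T) t : ~ A t -> indC R A t = 0.
Proof. by move=> At; rewrite /indC asboolF. Qed.

Lemma indC_neq0 (T : Type) (A : set T) t : indC R A t != 0 <-> A t.
Proof.
by rewrite /indC; case: asboolP => At; rewrite ?oner_neq0 ?eqxx; split.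
Qed.

Lemma clopen_indC_continuous (T : topologicalType) (A : set T) :
  open A -> closed A -> continuous (indC R A).
Proof.
move=> oA cA t; apply: cvg_near_cst.
have [At|At] := pselect (A t).
  by apply: filterS (open_nbhs_nbhs (conj oA At)) => u Au; rewrite /= !indC1.
apply: filterS (open_nbhs_nbhs (conj (closed_openC cA) At)) => u Au.
by rewrite /= !indC0.
Qed.

Lemma bounded_functionsP (T : Type) (f : T -> C) : bounded_functions f ->
  exists2 M : R, 0 < M & forall t, `|f t| <= M%:X.
Proof.
move=> [M HM]; exists (`|M| + 1); first by rewrite ltr_wpDl.
move=> t; apply: (le_trans (HM t)); rewrite toCx_le.
by apply: (le_trans (ler_norm _)); rewrite lerDl.
Qed.

Lemma bounded_functions_cstar (T : Type) : cstar_subalgebra (@bounded_functions R T).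
Proof.
split=> //.
- by exists 0 => t; rewrite normr0.
- move=> f g [M fM] [N gN]; exists (M + N) => t.
  by rewrite toCxD; apply: (le_trans (ler_normD _ _)); rewrite lerD.
- move=> c f /bounded_functionsP[M M0 fM].
  have [r r0 E] := Cx_norm_real c.
  exists (r * M) => t; by rewrite normrM E toCxM ler_wpM2l // -toCx0 toCx_le.
- move=> f g [M fM] [N gN]; exists (M * N) => t.
  by rewrite normrM toCxM ler_pM.
- by move=> f [M fM]; exists M => t; rewrite norm_conjC.
- move=> f H; have [g [M gM] gf] := H 1 ltr01.
  exists (M + 1) => t; rewrite toCxD -[f t](subrK (g t)) addrC.
  by apply: (le_trans (ler_normD _ _)); rewrite lerD.
Qed.

Lemma compact_norm_bounded (T : topologicalType) (K : set T) (f : T -> C) :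
  compact K -> continuous f -> exists M : R, forall t, K t -> `|f t| <= M%:X.
Proof.
move=> cK cf.
apply: (compact_ind (P := fun A => exists M : R, forall t, A t -> `|f t| <= M%:X)) cK _ _ _ _.
- by exists 0.
- move=> A B [M fM] [N fN]; exists (Num.max M N) => t [/fM|/fN] H; apply: le_trans H _;
    by rewrite toCx_le le_max lexx ?orbT.
- by move=> A B AB [M fM]; exists M => t /AB/fM.
- move=> t _; have [r r0 E] := Cx_norm_real (f t).
  have /cvgCxP/(_ 1 ltr01) H := cf t.
  exists [set u | `|f u - f t| < (1 : R)%:X]; first exact: H.
  exists (1 + r) => u /= /ltW fu; rewrite toCxD -E -[f u](subrK (f t)).
  by apply: (le_trans (ler_normD _ _)); rewrite lerD2r.
Qed.

Lemma Cc_bounded (T : topologicalType) : @Cc R T `<=` @bounded_functions R T.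
Proof.
move=> f [cf Kf]; have [M fM] := compact_norm_bounded Kf cf.
exists (`|M|) => t; have [ft|ft] := eqVneq (f t) 0.
  by rewrite ft normr0 -toCx0 toCx_le.
apply: le_trans (fM t _) _; first exact: subset_closure.
by rewrite toCx_le ler_norm.
Qed.

Lemma Cc_mul (T : topologicalType) (f k : T -> C) :
  Cc f -> continuous k -> Cc (fun t => f t * k t).
Proof.
move=> [cf Kf] ck; split; first by move=> t; apply: cvgM; [exact: cf|exact: ck].
apply: subclosed_compact Kf _; first exact: closed_closure.
by apply: closureS => t /=; apply: contra_neq => ->; rewrite mul0r.
Qed.

Lemma indC_Z_continuous u v : continuous (indC R (Z u v)).
Proof. apply: clopen_indC_continuous; [exact: Z_open|exact: Z_closed]. Qed.

Lemma indC_Z_Cc u v : Cc (indC R (Z u v)).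
Proof.
split; first exact: indC_Z_continuous.
have -> : [set g | indC R (Z u v) g != 0] = Z u v.
  by apply/seteqP; split=> g /indC_neq0.
by rewrite -(closure_id _).1; [exact: Z_compact|exact: Z_closed].
Qed.

Lemma indC_Z_C0 u v : C0 (indC R (Z u v)).
Proof.
split; first exact: indC_Z_continuous.
move=> e e0; exists (Z u v); first exact: Z_compact.
move=> g zg; have -> : indC R (Z u v) g = 0 := indC0 zg.
by rewrite normr0 -toCx0 toCx_lt.
Qed.

Lemma compact_Z_cover (K : set GX) : compact K ->
  exists l : seq (seq bool * seq bool), forall g, K g -> exists2 uv, uv \in l & Z uv.1 uv.2 g.
Proof.
move=> cK.
apply: (compact_ind (P := fun A => exists l : seq (seq bool * seq bool),
  forall g, A g -> exists2 uv, uv \in l & Z uv.1 uv.2 g)) cK _ _ _ _.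
- by exists [::].
- move=> A B [l lA] [l' lB]; exists (l ++ l') => g [/lA|/lB] [uv luv zg];
    by exists uv; rewrite // mem_cat luv ?orbT.
- by move=> A B AB [l lB]; exists l => g /AB/lB.
- move=> g _; have [u [v [zg _]]] := Z_extend g 0.
  exists (Z u v); first exact: nbhs_Z.
  by exists [:: (u, v)] => h zh; exists (u, v); rewrite // inE.
Qed.

Lemma Cc_cover (f : GX -> C) : Cc f ->
  exists l : seq (seq bool * seq bool),
    forall g, f g != 0 -> exists2 uv, uv \in l & Z uv.1 uv.2 g.
Proof.
move=> [_ /compact_Z_cover[l lP]]; exists l => g fg.
by apply: lP; exact: subset_closure.
Qed.

Lemma Cc_inv (f : GX -> C) : Cc f -> Cc (f \o GX_inv).
Proof.
move=> [cf Kf]; split.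
  move=> g; apply: continuous_comp; [exact: GX_inv_continuous|exact: cf].
have cK : compact (GX_inv @` closure [set g | f g != 0]).
  apply: continuous_compact Kf; exact/continuous_subspaceT/GX_inv_continuous.
apply: subclosed_compact cK _; first exact: closed_closure.
move=> g cg; exists (GX_inv g); last exact: GX_invK.
move=> N /GX_inv_continuous /cg [h [/= fh Nh]].
by exists (GX_inv h).
Qed.

(** The range is injective on [Z u v], so the sum has one term: convolution with a function
    supported on a bisection is a weighted translation by a partial homeomorphism. *)
Lemma convolve_rng u v (h : GX -> C) (d : X -> C) g :
  (forall g', h g' != 0 -> Z u v g') -> Z u v g ->
  convolve h d (grange g) = h g * d (gsource g).
Proof.
move=> hZ zg; rewrite /convolve -(fsbig_widen [set g]) ?fsbig_set1 //.
  by move=> _ ->.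
move=> g' [/= r g'g]; have [->|/hZ zg'] := eqVneq (h g') 0; first by rewrite mul0r.
by case: g'g; exact: Z_rng_inj zg' zg r.
Qed.

Lemma convolve_out (h : GX -> C) (d : X -> C) x :
  (forall g, h g != 0 -> grange g <> x) -> convolve h d x = 0.
Proof.
move=> hx; rewrite /convolve fsbig1 // => g rg.
by have [->|/hx] := eqVneq (h g) 0; first by rewrite mul0r.
Qed.

Lemma ler_norm_sum_seq (I : Type) (r : seq I) (P : pred I) (F : I -> C) (M : R) :
  0 <= M -> (forall i, `|F i| <= M%:X) ->
  `|\sum_(i <- r | P i) F i| <= ((size r)%:R * M)%:X.
Proof.
move=> M0 FM; elim: r => [|i r IH]; first by rewrite big_nil normr0 mul0r.
rewrite big_cons /= -addn1 natrD mulrDl mul1r toCxD; case: ifP => _.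
  by rewrite addrC; apply: (le_trans (ler_normD _ _)); rewrite lerD.
by apply: (le_trans IH); rewrite lerDl -toCx0 toCx_le.
Qed.

Lemma convolve_bounded (h : GX -> C) (d : X -> C) :
  Cc h -> bounded_functions d -> bounded_functions (convolve h d).
Proof.
move=> Ch bd; have [l lP] := Cc_cover Ch.
have [M M0 hM] := bounded_functionsP (Cc_bounded Ch).
have [N N0 dN] := bounded_functionsP bd.
exists ((size l)%:R * (M * N)) => x.
(* Each cylinder of the cover meets the range fibre over [x] at most once. The default [GX_unit x]
   keeps all sections inside this fibre, so that at most [size l] terms contribute. *)
pose sec (uv : seq bool * seq bool) :=
  xget (GX_unit x) [set g | Z uv.1 uv.2 g /\ grange g = x].
have secx uv : grange (sec uv) = x by rewrite /sec; case: xgetP => // g _ [].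
pose r := undup [seq sec uv | uv <- l].
rewrite /convolve (fsbigE r) ?undup_uniq //.
- apply: (@le_trans _ _ ((size r)%:R * (M * N))%:X).
    apply: ler_norm_sum_seq; first by rewrite mulr_ge0 // ltW.
    by move=> g; rewrite normrM toCxM ler_pM.
  rewrite toCx_le ler_pM2r ?mulr_gt0 // ler_nat.
  by rewrite (leq_trans (size_undup _)) // size_map.
- by move=> g /=; rewrite mem_undup => /mapP[uv _ ->].
- move=> g /= gx; apply: contraNeq; rewrite mulf_eq0 negb_or => /andP[/lP[uv luv zg] _].
  rewrite mem_undup; apply/mapP; exists uv => //.
  rewrite /sec; case: xgetP => [g' _ [zg' gx']|/(_ g)[]//].
  by apply: Z_rng_inj zg zg' _; rewrite gx.
Qed.

(** One admissible algebra has to be exhibited: the intersection of an empty family would consist of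
    all functions, bounded or not. *)
Lemma smallest_cstar (T : Type) (Q : set (T -> C) -> Prop) (G : set (T -> C)) :
  (exists B, [/\ cstar_subalgebra B, Q B & G `<=` B]) ->
  cstar_subalgebra (smallest [set B | cstar_subalgebra B /\ Q B] G).
Proof.
move=> [B0 [cB0 QB0 GB0]]; split.
- move=> f Hf; exact: (cstar_bounded cB0 (Hf B0 (conj (conj cB0 QB0) GB0))).
- by move=> B [[cB _] _]; exact: cstar_0.
- by move=> f g Hf Hg B HB; have [[cB _] _] := HB; apply: cstar_add; [exact: Hf|exact: Hg].
- by move=> c f Hf B HB; have [[cB _] _] := HB; apply: cstar_scale; exact: Hf.
- by move=> f g Hf Hg B HB; have [[cB _] _] := HB; apply: cstar_mul; [exact: Hf|exact: Hg].
- by move=> f Hf B HB; have [[cB _] _] := HB; apply: cstar_conj; exact: Hf.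
- move=> f Hf B HB; have [[cB _] _] := HB; apply: cstar_closed => // e /Hf[g Hg fg].
  by exists g => //; exact: Hg.
Qed.

Lemma X_continuous_bounded (f : X -> C) : continuous f -> bounded_functions f.
Proof.
move=> cf; have [M fM] := compact_norm_bounded X_compact cf.
by exists M => x; exact: fM.
Qed.

Lemma Dalg_witness : exists B, [/\ @cstar_subalgebra R X B,
  (forall h d, @Cc R GX h -> B d -> B (convolve h d)) &
  [set f : X -> C | continuous f] `<=` B].
Proof.
exists (@bounded_functions R X); split; first exact: bounded_functions_cstar.
  by move=> h d; exact: convolve_bounded.
by move=> f; exact: X_continuous_bounded.
Qed.

Lemma Dalg_cstar : cstar_subalgebra (@Dalg R).
Proof. exact: (smallest_cstar Dalg_witness). Qed.

Lemma Dalg_convolve h d : @Cc R GX h -> @Dalg R d -> @Dalg R (convolve h d).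
Proof. by move=> Ch Dd B HB; have [[_ cB] _] := HB; apply: cB => //; exact: Dd. Qed.

Lemma Dalg_continuous (f : X -> C) : continuous f -> @Dalg R f.
Proof. by move=> cf B [_]; exact. Qed.

Lemma Dalg1 : @Dalg R (fun=> 1).
Proof. by apply: Dalg_continuous; exact: cst_continuous. Qed.

Lemma bounded_sub_Aalg_gen : [set a | exists f d, [/\ @Cc R GX f, @Dalg R d &
       a = (fun g => f g * d (gsource g))]] `<=` @bounded_functions R GX.
Proof.
move=> _ [f [d [Cf Dd ->]]].
have [M fM] := Cc_bounded Cf; have [N dN] := cstar_bounded Dalg_cstar Dd.
by exists (M * N) => g; rewrite normrM toCxM ler_pM.
Qed.

Lemma Aalg_cstar : cstar_subalgebra (@Aalg R).
Proof.
have := @smallest_cstar GX (fun=> True) _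
  (ex_intro _ _ (And3 (bounded_functions_cstar GX) I bounded_sub_Aalg_gen)).
congr (cstar_subalgebra (smallest _ _)).
by apply/seteqP; split=> B; [case|].
Qed.

Lemma Aalg_gen f d : @Cc R GX f -> @Dalg R d ->
  @Aalg R (fun g => f g * d (gsource g)).
Proof. by move=> Cf Dd B [_]; apply; exists f, d. Qed.

Lemma Aalg_Cc f : @Cc R GX f -> @Aalg R f.
Proof.
move=> Cf; have := Aalg_gen Cf Dalg1.
by congr (@Aalg R); apply: funext => g; rewrite mulr1.
Qed.

Lemma Aalg_ind (P : set (GX -> C)) : cstar_subalgebra P ->
  (forall f d, @Cc R GX f -> @Dalg R d -> P (fun g => f g * d (gsource g))) ->
  @Aalg R `<=` P.
Proof.
by move=> cP PG; apply: smallest_sub => // _ [f [d [Cf Dd ->]]]; exact: PG.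
Qed.

(** For [g] in [Z u v], the only arrow of [Z v u] with range [gsource g] is the inverse of [g].
    Hence [d (grange g)] is the value at [gsource g] of a convolution, and the stability of [Dalg]
    under convolution turns it into a function of the source. *)
Lemma Aalg_indC_rng u v d : @Dalg R d ->
  @Aalg R (fun g => indC R (Z u v) g * d (grange g)).
Proof.
move=> Dd; have := Aalg_gen (indC_Z_Cc u v) (Dalg_convolve (indC_Z_Cc v u) Dd).
congr (@Aalg R); apply: funext => g.
have [zg|zg] := pselect (Z u v g); last by rewrite indC0 // !mul0r.
have := @convolve_rng v u (indC R (Z v u)) d (GX_inv g) _ (Z_inv zg).
move=> /= ->; last by move=> g' /indC_neq0.
by rewrite (indC1 (Z_inv zg)) mul1r.
Qed.

Lemma Aalg_Cc_rng f d : @Cc R GX f -> @Dalg R d ->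
  @Aalg R (fun g => f g * d (grange g)).
Proof.
move=> Cf Dd; have [l lP] := Cc_cover Cf.
pose V (l : seq (seq bool * seq bool)) : set GX :=
  [set g | exists2 uv, uv \in l & Z uv.1 uv.2 g].
have cA := Aalg_cstar.
have VA : @Aalg R (fun g => indC R (V l) g * d (grange g)).
  elim: l {lP} => [|uv l IH].
    have := cstar_0 cA; congr (@Aalg R); apply: funext => g.
    by rewrite indC0 ?mul0r // => -[].
  have Zd := Aalg_indC_rng uv.1 uv.2 Dd.
  (* Inclusion-exclusion for the indicator of the union of one more cylinder with the previous
     ones. *)
  have := cstar_sub cA (cstar_add cA IH Zd)
    (cstar_mul cA IH (Aalg_Cc (indC_Z_Cc uv.1 uv.2))).
  congr (@Aalg R); apply: funext => g.
  have VE : V (uv :: l) g <-> Z uv.1 uv.2 g \/ V l g.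
    split=> [[uv']|[zg|[uv' luv' zg']]].
    - by rewrite inE => /predU1P[->|luv']; [left|right; exists uv'].
    - by exists uv; rewrite // inE eqxx.
    - by exists uv'; rewrite // inE luv' orbT.
  have [zg|zg] := pselect (Z uv.1 uv.2 g); have [vg|vg] := pselect (V l g);
    rewrite ?(indC1 zg) ?(indC0 zg) ?(indC1 vg) ?(indC0 vg).
  - by rewrite indC1; [ring|rewrite VE; left].
  - by rewrite indC1; [ring|rewrite VE; left].
  - by rewrite indC1; [ring|rewrite VE; right].
  - by rewrite indC0; [ring|rewrite VE => -[]].
have := cstar_mul cA (Aalg_Cc Cf) VA; congr (@Aalg R); apply: funext => g.
have [->|/lP vg] := eqVneq (f g) 0; first by rewrite !mul0r.
by rewrite indC1 // mul1r.
Qed.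

(** Inversion exchanges source and range, so it carries the generators into the functions treated by
    [Aalg_Cc_rng]. This is what makes the inverse, and through it the range, continuous on the
    cover. *)
Lemma Aalg_inv a : @Aalg R a -> @Aalg R (a \o GX_inv).
Proof.
have cA := Aalg_cstar.
suff: @Aalg R `<=` [set a | bounded_functions a /\ @Aalg R (a \o GX_inv)].
  by move=> H /H[].
have cb := bounded_functions_cstar GX.
apply: Aalg_ind; last first.
  move=> f d Cf Dd; split; first by apply: bounded_sub_Aalg_gen; exists f, d.
  exact: (Aalg_Cc_rng (Cc_inv Cf) Dd).
split.
- by move=> f [].
- by split; [exact: (cstar_0 cb)|exact: (cstar_0 cA)].
- by move=> f g [bf Af] [bg Ag]; split; [exact: (cstar_add cb)|exact: (cstar_add cA Af Ag)].
- by move=> c f [bf Af]; split; [exact: (cstar_scale cb)|exact: (cstar_scale cA c Af)].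
- by move=> f g [bf Af] [bg Ag]; split; [exact: (cstar_mul cb)|exact: (cstar_mul cA Af Ag)].
- by move=> f [bf Af]; split; [exact: (cstar_conj cb)|exact: (cstar_conj cA Af)].
- move=> f H; split.
    by apply: (cstar_closed cb) => e /H[g [bg _] fg]; exists g.
  apply: (cstar_closed cA) => e /H[g [_ Ag] fg]; exists (g \o GX_inv) => // t.
  exact: fg.
Qed.

End BoundedFunctions.

(** * The canonical map and the operations of the cover *)

Definition src_section (u v : seq bool) (y : X) : GX :=
  xget (GX_unit y) [set g | Z u v g /\ gsource g = y].

(** The indicator cuts off the points at which [src_section] takes its default value. *)
Definition push (R : realType) (u v : seq bool) (a : GX -> Cx R) (y : X) : Cx R :=
  indC R (gsource @` Z u v) y * a (src_section u v y).

Section Push.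
Variable R : realType.
Local Notation C := (Cx R).
Local Notation A := (@Aalg R).
Local Notation D := (@Dalg R).

Let cA : cstar_subalgebra A := @Aalg_cstar R.
Let cD : cstar_subalgebra D := @Dalg_cstar R.

Lemma src_sectionP u v y : (gsource @` Z u v) y -> Z u v (src_section u v y) /\ gsource (src_section u v y) = y.
Proof. by move=> [g zg <-]; rewrite /src_section; case: xgetP => // /(_ g)[]. Qed.

Lemma src_section_src u v g : Z u v g -> src_section u v (gsource g) = g.
Proof.
move=> zg; have [zl sl] : Z u v (src_section u v (gsource g)) /\ _ := src_sectionP (imageP gsource zg).
exact: Z_src_inj zl zg sl.
Qed.

Lemma push_src u v (a : GX -> C) g : Z u v g -> push u v a (gsource g) = a g.
Proof. by move=> zg; rewrite /push indC1 ?mul1r ?src_section_src //; exists g. Qed.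

Lemma push_out u v (a : GX -> C) y : ~ (gsource @` Z u v) y -> push u v a y = 0.
Proof. by move=> ny; rewrite /push indC0 // mul0r. Qed.

(** The pushed function is the convolution with 1 of [f \o GX_inv] cut down to [Z v u]. For [f] the
    indicator of [Z u v] it yields the indicator of the source image, a function that need not be
    continuous on [X]. *)
Lemma Dalg_push_Cc u v f : @Cc R GX f -> D (push u v f).
Proof.
move=> Cf; have Cf' := Cc_mul (Cc_inv Cf) (@indC_Z_continuous R v u).
have := Dalg_convolve Cf' (@Dalg1 R); congr D; apply: funext => y.
have supp g : (f \o GX_inv) g * indC R (Z v u) g != 0 -> Z v u g.
  by rewrite mulf_eq0 negb_or => /andP[_ /indC_neq0].
have [[g zg <-]|ny] := pselect ((gsource @` Z u v) y).
  rewrite push_src // -[gsource g]/(grange (GX_inv g)).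
  rewrite (convolve_rng _ supp (Z_inv zg)) /= GX_invK (indC1 _ (Z_inv zg)).
  by rewrite !mulr1.
rewrite push_out // convolve_out // => g /supp zg gy; apply: ny.
by exists (GX_inv g) => //; exact: Z_inv.
Qed.

Lemma Dalg_push u v a : A a -> D (push u v a).
Proof.
(* [push u v a] says nothing about [a] off [Z u v], so boundedness is carried along in order that
   the predicate define a C*-subalgebra. *)
suff: A `<=` [set a | bounded_functions a /\ D (push u v a)] by move=> H /H[].
have cb := bounded_functions_cstar R GX.
have zz y : (gsource @` Z u v) y \/ ~ (gsource @` Z u v) y by exact: EM.
apply: Aalg_ind; last first.
  move=> f d Cf Dd; split; first by apply: bounded_sub_Aalg_gen; exists f, d.
  have := cstar_mul cD (Dalg_push_Cc u v Cf) Dd; congr D; apply: funext => y.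
  have [[g zg <-]|ny] := zz y; first by rewrite !push_src.
  by rewrite !push_out // mul0r.
split.
- by move=> f [].
- split; first exact: (cstar_0 cb).
  have := cstar_0 cD; congr D; apply: funext => y.
  by rewrite /push mulr0.
- move=> f g [bf Df] [bg Dg]; split; first exact: (cstar_add cb).
  have := cstar_add cD Df Dg; congr D; apply: funext => y.
  by rewrite /push mulrDr.
- move=> c f [bf Df]; split; first exact: (cstar_scale cb).
  have := cstar_scale cD c Df; congr D; apply: funext => y.
  by rewrite /push mulrCA.
- move=> f g [bf Df] [bg Dg]; split; first exact: (cstar_mul cb).
  have := cstar_mul cD Df Dg; congr D; apply: funext => y.
  have [[h zh <-]|ny] := zz y; first by rewrite !push_src.
  by rewrite !push_out // mul0r.
- move=> f [bf Df]; split; first exact: (cstar_conj cb).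
  have := cstar_conj cD Df; congr D; apply: funext => y.
  have [[h zh <-]|ny] := zz y; first by rewrite !push_src.
  by rewrite !push_out // rmorph0.
- move=> f H; split; first by apply: (cstar_closed cb) => e /H[g [bg _] fg]; exists g.
  apply: (cstar_closed cD) => e e0; have [g [_ Dg] fg] := H e e0; exists (push u v g) => // y.
  have [[h zh <-]|ny] := zz y; first by rewrite !push_src.
  by rewrite !push_out // subrr normr0 -toCx0 toCx_le ltW.
Qed.

Lemma Dalg_unit a : A a -> D (a \o GX_unit).
Proof.
suff: A `<=` [set a | bounded_functions a /\ D (a \o GX_unit)] by move=> H /H[].
have cb := bounded_functions_cstar R GX.
apply: Aalg_ind; last first.
  move=> f d Cf Dd; split; first by apply: bounded_sub_Aalg_gen; exists f, d.
  have Cu : continuous (f \o GX_unit).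
    by move=> x; apply: continuous_comp; [exact: GX_unit_continuous|exact: Cf.1].
  exact: (cstar_mul cD (Dalg_continuous Cu) Dd).
split.
- by move=> f [].
- by split; [exact: (cstar_0 cb)|exact: (cstar_0 cD)].
- by move=> f g [bf Df] [bg Dg]; split; [exact: (cstar_add cb)|exact: (cstar_add cD Df Dg)].
- by move=> c f [bf Df]; split; [exact: (cstar_scale cb)|exact: (cstar_scale cD c Df)].
- by move=> f g [bf Df] [bg Dg]; split; [exact: (cstar_mul cb)|exact: (cstar_mul cD Df Dg)].
- by move=> f [bf Df]; split; [exact: (cstar_conj cb)|exact: (cstar_conj cD Df)].
- move=> f H; split; first by apply: (cstar_closed cb) => e /H[g [bg _] fg]; exists g.
  apply: (cstar_closed cD) => e /H[g [_ Dg] fg]; exists (g \o GX_unit) => // t.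
  exact: fg.
Qed.

End Push.

(** * The projection to [GX] and limits of arrows *)

Section CoverMap.
Variable R : realType.
Local Notation C := (Cx R).
Local Notation A := (@Aalg R).
Local Notation D := (@Dalg R).
Local Notation indZ u v := (indC R (Z u v)).

Let cA : cstar_subalgebra A := @Aalg_cstar R.
Let cD : cstar_subalgebra D := @Dalg_cstar R.

Lemma indZ_A u v : A (indZ u v).
Proof. by apply: Aalg_Cc; exact: indC_Z_Cc. Qed.

Lemma near_filter_A (phi : Ghat R) : ProperFilter (near_filter phi).
Proof. exact: near_filter_proper. Qed.

Lemma near_filter_D (chi : Xhat R) : ProperFilter (near_filter chi).
Proof. exact: near_filter_proper. Qed.

Lemma app_indZ_or (phi : Ghat R) u v : app phi (indZ u v) = 1 \/ app phi (indZ u v) = 0.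
Proof.
have : app phi (indZ u v) * (app phi (indZ u v) - 1) = 0.
  rewrite mulrBr mulr1 -(appM cA) //; try exact: indZ_A.
  apply/eqP; rewrite subr_eq0; apply/eqP; congr app; apply: funext => g.
  by have [zg|zg] := pselect (Z u v g); rewrite ?(indC1 _ zg) ?(indC0 _ zg) ?mulr1 ?mulr0.
by move/eqP; rewrite mulf_eq0 subr_eq0 => /orP[]/eqP; [right|left].
Qed.

Lemma tends_indZ (I : Type) (F : set_system I) (k : I -> GX) (phi : Ghat R) u v :
  ProperFilter F -> tends F k phi -> app phi (indZ u v) = 1 <-> F (k @^-1` Z u v).
Proof.
move=> FF kphi; have H := kphi _ (indZ_A u v); split=> [E|FZ].
  rewrite E in H; have F1 : F [set i | indZ u v (k i) != 0].
    by apply: (cvgr_neq0 _ H); exact: oner_neq0.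
  by apply: filterS F1 => i /indC_neq0.
apply: Cx_cvg_unique _ H _; apply: cvg_near_cst; apply: filterS FZ => i zi.
by rewrite /= indC1.
Qed.

(** Functions such as [d \o gsource] need not lie in [A], but their products with a cylinder
    indicator do; along a filter that ends up in the cylinder this is enough for convergence. *)
Lemma tends_local (I : Type) (F : set_system I) (k : I -> GX) (phi : Ghat R) u v
    (a : GX -> C) : Filter F -> tends F k phi -> F (k @^-1` Z u v) ->
  A (fun g => indZ u v g * a g) ->
  a \o k @ F --> app phi (fun g => indZ u v g * a g).
Proof.
move=> FF kphi FZ Aa; apply: cvg_trans (kphi _ Aa); apply: near_eq_cvg.
by apply: filterS FZ => i zi; rewrite /= indC1 // mul1r.
Qed.

(** Otherwise the points close to [phi] leave every cylinder. The support of a generator is covered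
    by finitely many cylinders, so [phi] kills all generators, hence all of [A], against
    [app_neq0]. *)
Lemma Ghat_Z (phi : Ghat R) : exists u v, app phi (indZ u v) = 1.
Proof.
apply: contrapT => H.
have FP := near_filter_A phi.
have tn := @tends_near _ _ _ cA phi.
have {}H u v : near_filter phi (~` Z u v).
  have [E|E] := app_indZ_or phi u v; first by exfalso; apply: H; exists u, v.
  have /cvgCxP/(_ 1 ltr01) := tn _ (indZ_A u v).
  rewrite E; apply: filterS => g /=; rewrite subr0 => + zg.
  by rewrite indC1 // normr1 ltxx.
pose P := [set a | A a /\ app phi a = 0].
have PE a : A a -> app phi a = 0 <-> a @ near_filter phi --> (0 : C).
  move=> Aa; split=> [<-|a0]; first exact: tn.
  exact: Cx_cvg_unique _ (tn _ Aa) a0.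
have AP : A `<=` P.
  apply: Aalg_ind; last first.
    move=> f d Cf Dd; have Af := Aalg_gen Cf Dd; split => //; apply/PE => //.
    have [l lP] := Cc_cover Cf.
    have : near_filter phi [set g | forall uv, uv \in l -> ~ Z uv.1 uv.2 g].
      elim: l {lP} => [|uv l IH]; first by apply: filterE.
      apply: filterS (filterI (H uv.1 uv.2) IH) => g [/= h1 h2] uv'.
      by rewrite inE => /predU1P[->//|/h2].
    move=> Fl; apply: cvg_near_cst; apply: filterS Fl => g gl /=.
    have [->|/lP[uv luv zg]] := eqVneq (f g) 0; first by rewrite mul0r.
    by case: (gl uv luv).
  split.
  - by move=> f [/(cstar_bounded cA)].
  - split; first exact: (cstar_0 cA).
    by apply/PE; [exact: (cstar_0 cA)|exact: cvg_cst].
  - move=> f g [Af f0] [Ag g0]; split; first exact: (cstar_add cA).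
    by rewrite (appD cA) // f0 g0 addr0.
  - move=> c f [Af f0]; split; first exact: (cstar_scale cA).
    by rewrite (appZ cA) // f0 mulr0.
  - move=> f g [Af f0] [Ag g0]; split; first exact: (cstar_mul cA).
    by rewrite (appM cA) // f0 mul0r.
  - move=> f [Af f0]; have Af' := cstar_conj cA Af; split=> //; apply/PE => //.
    have /cvgCxP f0' := (PE f Af).1 f0; apply/cvgCxP => e /f0'.
    by apply: filterS => g; rewrite !subr0 norm_conjC.
  - move=> f Hf; have Af : A f by apply: (cstar_closed cA) => e /Hf[g [Ag _] fg]; exists g.
    split=> //; apply/eqP; rewrite -normr_eq0; have [r r0 E] := Cx_norm_real (app phi f).
    rewrite E -toCx0 (inj_eq (@toCx_inj R)); rewrite eq_le r0 andbT.
    apply/ler_addgt0Pr => e e0; rewrite add0r -toCx_le -E.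
    have [g [Ag g0] fg] := Hf e e0.
    rewrite -[app phi f]subr0 -g0 -(appB cA) //.
    by apply: (app_norm_le cA) => //; exact: (cstar_sub cA).
have [f Af] := app_neq0 phi.
by have [_ ->] := AP f Af; rewrite eqxx.
Qed.

(** The filter of [phi] contains a compact cylinder and so clusters at some [g]. Along a finer
    filter converging to [g], a continuous function tends both to its value at [g] and to its value
    under [phi]; thus the default in [cover_map] is never reached. *)
Lemma cover_map_spec (phi : Ghat R) f : A f -> C0 f -> app phi f = f (cover_map phi).
Proof.
have FP := near_filter_A phi.
have [u [v E]] := Ghat_Z phi.
have FZ : near_filter phi (Z u v) := (tends_indZ u v FP (@tends_near _ _ _ cA phi)).1 E.
have [g [_ clg]] := @Z_compact u v _ FP FZ.
suff H : exists g, forall f : set_type A, C0 (set_val f) -> spectrum_app phi f = set_val f g.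
  move=> Af C0f; have := xgetPex (GX_unit Xzero) H.
  by move=> /(_ (exist _ f (mem_set Af)) C0f); rewrite -app_val.
exists g => {}f [cf _]; rewrite appE.
move: clg; rewrite cluster_cvgE => -[G GP [Gg FG]].
apply: (@Cx_cvg_unique R _ G (set_val f)).
  move=> N /(@tends_near _ _ _ cA phi _ (set_valP f)); exact: FG.
exact: cvg_comp Gg (cf g).
Qed.

Lemma Z_cover_map (phi : Ghat R) u v : Z u v (cover_map phi) <-> app phi (indZ u v) = 1.
Proof.
rewrite cover_map_spec; [|exact: indZ_A|exact: indC_Z_C0].
split=> [zg|E]; first by rewrite indC1.
by apply/(@indC_neq0 R); rewrite E oner_neq0.
Qed.

Lemma tends_cover_map (I : Type) (F : set_system I) (k : I -> GX) (phi : Ghat R) :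
  ProperFilter F -> tends F k phi -> k @ F --> cover_map phi.
Proof.
move=> FF kphi; have FF1 : Filter (k @ F) by exact: fmap_filter.
apply: (@cvg_GX _ FF1) => u v /Z_cover_map E.
exact: (tends_indZ u v FF kphi).1.
Qed.

Lemma cover_map_unique (I : Type) (F : set_system I) (k : I -> GX) (phi : Ghat R) g :
  ProperFilter F -> tends F k phi -> k @ F --> g -> cover_map phi = g.
Proof.
move=> FF /(tends_cover_map FF) h1 h2.
exact: (cvg_unique GX_hausdorff h1 h2).
Qed.

Lemma cover_map_eval g (phi : Ghat R) : is_evaluation g phi -> cover_map phi = g.
Proof.
move=> H; have FF : ProperFilter (principal_filter tt) := @ultra_proper _ _ (principal_filter_ultra tt).
apply: (cover_map_unique FF (is_evaluation_tends _ H)).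
exact: cvg_cst.
Qed.

Lemma hsrc_exists (phi : Ghat R) : exists chi : Xhat R, tends (near_filter phi) gsource chi.
Proof.
have FP := near_filter_A phi; have tn := @tends_near _ _ _ cA phi.
have [u [v E]] := Ghat_Z phi.
have FZ : near_filter phi (id @^-1` Z u v) := (tends_indZ u v FP tn).1 E.
apply: tends_exists => [d Dd|].
  exists (app phi (fun g => indZ u v g * d (gsource g))).
  apply: (tends_local (a := d \o gsource) FP tn FZ).
  exact: (Aalg_gen (@indC_Z_Cc R u v) Dd).
by exists (fun=> 1), 1; split; [exact: Dalg1|exact: oner_neq0|exact: cvg_cst].
Qed.

Lemma hrng_exists (phi : Ghat R) : exists chi : Xhat R, tends (near_filter phi) grange chi.
Proof.
have FP := near_filter_A phi; have tn := @tends_near _ _ _ cA phi.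
have [u [v E]] := Ghat_Z phi.
have FZ : near_filter phi (id @^-1` Z u v) := (tends_indZ u v FP tn).1 E.
apply: tends_exists => [d Dd|].
  exists (app phi (fun g => indZ u v g * d (grange g))).
  apply: (tends_local (a := d \o grange) FP tn FZ).
  exact: (Aalg_indC_rng u v Dd).
by exists (fun=> 1), 1; split; [exact: Dalg1|exact: oner_neq0|exact: cvg_cst].
Qed.

Lemma hinv_exists (phi : Ghat R) : exists psi : Ghat R, tends (near_filter phi) GX_inv psi.
Proof.
have FP := near_filter_A phi; have tn := @tends_near _ _ _ cA phi.
have [u [v E]] := Ghat_Z phi.
have FZ : near_filter phi (id @^-1` Z u v) := (tends_indZ u v FP tn).1 E.
apply: tends_exists => [a Aa|].
  by exists (app phi (a \o GX_inv)); exact: (tn _ (Aalg_inv Aa)).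
exists (indZ v u), 1; split; [exact: indZ_A|exact: oner_neq0|].
apply: cvg_near_cst; apply: filterS FZ => g zg /=.
by rewrite indC1 //; exact: Z_inv.
Qed.

Lemma hunit_exists (chi : Xhat R) : exists psi : Ghat R, tends (near_filter chi) GX_unit psi.
Proof.
have FP := near_filter_D chi; have tn := @tends_near _ _ _ cD chi.
apply: tends_exists => [a Aa|].
  by exists (app chi (a \o GX_unit)); exact: (tn _ (Dalg_unit Aa)).
exists (indZ [::] [::]), 1; split; [exact: indZ_A|exact: oner_neq0|].
apply: cvg_near_cst; apply: filterE => g /=.
by rewrite indC1 //; exact/Z_unit.
Qed.

Definition hsrc (phi : Ghat R) : Xhat R := sval (cid (hsrc_exists phi)).
Definition hrng (phi : Ghat R) : Xhat R := sval (cid (hrng_exists phi)).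
Definition hinv (phi : Ghat R) : Ghat R := sval (cid (hinv_exists phi)).
Definition hunit (chi : Xhat R) : Ghat R := sval (cid (hunit_exists chi)).

Section Tends.
Variables (I : Type) (F : set_system I).
Context {FF : ProperFilter F}.

Lemma hsrc_tends (k : I -> GX) phi : tends F k phi -> tends F (gsource \o k) (hsrc phi).
Proof. by move=> H; apply: tends_comp H _; rewrite /hsrc; case: cid. Qed.

Lemma hrng_tends (k : I -> GX) phi : tends F k phi -> tends F (grange \o k) (hrng phi).
Proof. by move=> H; apply: tends_comp H _; rewrite /hrng; case: cid. Qed.

Lemma hinv_tends (k : I -> GX) phi : tends F k phi -> tends F (GX_inv \o k) (hinv phi).
Proof. by move=> H; apply: tends_comp H _; rewrite /hinv; case: cid. Qed.

Lemma hunit_tends (k : I -> X) chi : tends F k chi -> tends F (GX_unit \o k) (hunit chi).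
Proof. by move=> H; apply: tends_comp H _; rewrite /hunit; case: cid. Qed.

Lemma tends_near_eq (T : Type) (B : set (T -> C)) (k k' : I -> T) (phi : spectrum B) :
  F [set i | k i = k' i] -> tends F k phi -> tends F k' phi.
Proof.
move=> kk' kphi f Bf; apply: cvg_trans (kphi f Bf); apply: near_eq_cvg.
by apply: filterS kk' => i /= ->.
Qed.

(** Arrows confined to one bisection converge as soon as their sources do, since there [a] is the
    composite of [push u v a] with the source. Every arrow of the cover not given in advance is
    obtained in this way. *)
Lemma ghat_exists (k : I -> GX) chi u v : F (k @^-1` Z u v) ->
  tends F (gsource \o k) chi -> exists xi, tends F k xi /\ hsrc xi = chi.
Proof.
move=> FZ kchi.
have H a : A a -> a \o k @ F --> app chi (push u v a).
  move=> Aa; apply: cvg_trans (kchi _ (Dalg_push u v Aa)); apply: near_eq_cvg.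
  by apply: filterS FZ => i zi; rewrite /= push_src.
have [||xi kxi] := @tends_exists R GX A I F k FF.
- by move=> a Aa; exists (app chi (push u v a)); exact: H.
- exists (indZ u v), 1; split; [exact: indZ_A|exact: oner_neq0|].
  by apply: cvg_near_cst; apply: filterS FZ => i zi; rewrite /= indC1.
exists xi; split=> //.
exact: (tends_unique FF (hsrc_tends kxi) kchi).
Qed.

End Tends.

Lemma app_push (phi : Ghat R) u v a : A a -> app phi (indZ u v) = 1 ->
  app phi a = app (hsrc phi) (push u v a).
Proof.
move=> Aa E; have FP := near_filter_A phi; have tn := @tends_near _ _ _ cA phi.
have FZ := (tends_indZ u v FP tn).1 E.
apply: Cx_cvg_unique _ (tn a Aa) _.
apply: cvg_trans (hsrc_tends tn (Dalg_push u v Aa)); apply: near_eq_cvg.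
by apply: filterS FZ => g zg; rewrite /= push_src.
Qed.

Lemma Ghat_eq_local (phi psi : Ghat R) u v : app phi (indZ u v) = 1 ->
  app psi (indZ u v) = 1 -> hsrc phi = hsrc psi -> phi = psi.
Proof.
move=> E1 E2 s; apply: spectrum_eq => a Aa.
by rewrite (app_push Aa E1) (app_push Aa E2) s.
Qed.

Lemma Ghat_eq (phi psi : Ghat R) : cover_map phi = cover_map psi ->
  hsrc phi = hsrc psi -> phi = psi.
Proof.
move=> c; have [u [v [zg _]]] := Z_extend (cover_map phi) 0.
by apply: (@Ghat_eq_local _ _ u v); apply/Z_cover_map; rewrite -?c.
Qed.

End CoverMap.

(** * The cover groupoid *)

Section CoverGroupoid.
Variable R : realType.
Local Notation C := (Cx R).
Local Notation A := (@Aalg R).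
Local Notation D := (@Dalg R).
Local Notation indZ u v := (indC R (Z u v)).
Local Notation hsrc := (@hsrc R).
Local Notation hrng := (@hrng R).
Local Notation hinv := (@hinv R).
Local Notation hunit := (@hunit R).

Let cA : cstar_subalgebra A := @Aalg_cstar R.
Let cD : cstar_subalgebra D := @Dalg_cstar R.

Lemma tends_nearA (phi : Ghat R) : tends (near_filter phi) id phi.
Proof. exact: (@tends_near _ _ _ cA phi). Qed.

Lemma tends_nearD (chi : Xhat R) : tends (near_filter chi) id chi.
Proof. exact: (@tends_near _ _ _ cD chi). Qed.

Arguments tends_nearA : clear implicits.
Arguments tends_nearD : clear implicits.

Lemma Ghat_Zc (phi : Ghat R) : exists u v, Z u v (cover_map phi).
Proof. by have [u [v [zg _]]] := Z_extend (cover_map phi) 0; exists u, v. Qed.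

Lemma cover_hinv (phi : Ghat R) : cover_map (hinv phi) = GX_inv (cover_map phi).
Proof.
have FP := near_filter_A phi.
apply: (cover_map_unique FP (hinv_tends (tends_nearA phi))).
have H : id @ near_filter phi --> cover_map phi := tends_cover_map FP (tends_nearA phi).
by move=> N /GX_inv_continuous nN; exact: (H _ nN).
Qed.

Lemma hsrc_hinv (phi : Ghat R) : hsrc (hinv phi) = hrng phi.
Proof.
have FP := near_filter_A phi; have tn := tends_nearA phi.
exact: (tends_unique FP (hsrc_tends (hinv_tends tn)) (hrng_tends tn)).
Qed.

Lemma hrng_hinv (phi : Ghat R) : hrng (hinv phi) = hsrc phi.
Proof.
have FP := near_filter_A phi; have tn := tends_nearA phi.
exact: (tends_unique FP (hrng_tends (hinv_tends tn)) (hsrc_tends tn)).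
Qed.

Lemma hsrc_hunit (chi : Xhat R) : hsrc (hunit chi) = chi.
Proof.
have FP := near_filter_D chi; have tn := tends_nearD chi.
exact: (tends_unique FP (hsrc_tends (hunit_tends tn)) tn).
Qed.

Lemma hrng_hunit (chi : Xhat R) : hrng (hunit chi) = chi.
Proof.
have FP := near_filter_D chi; have tn := tends_nearD chi.
exact: (tends_unique FP (hrng_tends (hunit_tends tn)) tn).
Qed.

Lemma cover_hunit (chi : Xhat R) :
  cover_map (hunit chi) = GX_unit (grange (cover_map (hunit chi))).
Proof.
have FP := near_filter_D chi; have tn := tends_nearD chi.
apply/Z_unit/Z_cover_map/(tends_indZ _ _ FP (hunit_tends tn)).
by apply: filterE => x; exact/Z_unit.
Qed.

Lemma cover_hunit_hsrc (phi : Ghat R) :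
  cover_map (hunit (hsrc phi)) = GX_unit (gsource (cover_map phi)).
Proof.
have FP := near_filter_A phi; have tn := tends_nearA phi.
apply: (cover_map_unique FP (hunit_tends (hsrc_tends tn))).
have H : id @ near_filter phi --> cover_map phi := tends_cover_map FP tn.
by move=> N /GX_unit_continuous /gsource_continuous nN; exact: (H _ nN).
Qed.

Lemma cover_hunit_hrng (phi : Ghat R) :
  cover_map (hunit (hrng phi)) = GX_unit (grange (cover_map phi)).
Proof. by rewrite -hsrc_hinv cover_hunit_hsrc cover_hinv. Qed.

(** The projection from [Xhat] to [X] is read off through units, as the base point of
    [cover_map (hunit chi)]. *)
Lemma composable_cover_map (phi psi : Ghat R) : hsrc phi = hrng psi ->
  gsource (cover_map phi) = grange (cover_map psi).
Proof.
by move=> /(congr1 (fun chi => cover_map (hunit chi)));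
  rewrite cover_hunit_hsrc cover_hunit_hrng => -[].
Qed.

(** Composable pairs of the cover are limits of composable pairs of [GX]. The indicator of the
    source image of [Z u v] has value 1 at [hsrc phi = hrng psi], so the ranges of arrows near [psi]
    lie in this image and lift to [Z u v]. The lifts converge to [phi] because their sources
    converge to [hsrc phi]. *)
Lemma composable_tends (phi psi : Ghat R) : hsrc phi = hrng psi ->
  exists p : GX -> GX, tends (near_filter psi) p phi /\
    near_filter psi [set h | gsource (p h) = grange h].
Proof.
move=> sr; have FP := near_filter_A psi; have tn := tends_nearA psi.
have [u [v zg]] := Ghat_Zc phi; have E := (Z_cover_map phi u v).1 zg.
have Fd : near_filter psi [set h | (gsource @` Z u v) (grange h)].
  have H := @hrng_tends R _ _ FP _ _ tn _ (Dalg_push u v (@indZ_A R u v)).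
  rewrite -sr -(app_push (@indZ_A R u v) E) E in H.
  have F1 : near_filter psi [set h | push u v (indZ u v) (grange h) != 0].
    by apply: (cvgr_neq0 _ H); exact: oner_neq0.
  apply: filterS F1 => h /= h0; apply: contrapT => nh.
  by move: h0; rewrite push_out ?eqxx.
pose p := src_section u v \o grange.
have Fs : near_filter psi [set h | gsource (p h) = grange h].
  by apply: filterS Fd => h /src_sectionP[].
have FZ : near_filter psi (p @^-1` Z u v) by apply: filterS Fd => h /src_sectionP[].
have tp : tends (near_filter psi) (gsource \o p) (hsrc phi).
  rewrite sr; apply: tends_near_eq (hrng_tends tn).
  by apply: filterS Fs => h /= ->.
have [xi [txi sxi]] := ghat_exists FZ tp.
exists p; split; last exact: Fs.
suff -> : phi = xi by exact: txi.
by apply: (Ghat_eq_local E _ (esym sxi)); exact/(tends_indZ _ _ FP txi).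
Qed.

(** Both factors run along one common filter [F], left arbitrary so as to cover the filter of [psi]
    as well as the one-point filter used for evaluations. [Z_mul] keeps the products in a single
    bisection, where [ghat_exists] provides the limit. *)
Lemma mul_exists (I : Type) (F : set_system I) (p q : I -> GX) (phi psi : Ghat R) :
  ProperFilter F -> tends F p phi -> tends F q psi ->
  F [set i | gsource (p i) = grange (q i)] ->
  gsource (cover_map phi) = grange (cover_map psi) /\
  exists xi : Ghat R, [/\ tends F (fun i => GX_mul (p i) (q i)) xi,
    cover_map xi = GX_mul (cover_map phi) (cover_map psi),
    hsrc xi = hsrc psi & hrng xi = hrng phi].
Proof.
move=> FF tp tq Fpq.
have sr : hsrc phi = hrng psi.
  apply: (tends_unique FF (hsrc_tends tp)).
  apply: tends_near_eq (hrng_tends tq).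
  by apply: filterS Fpq => i /= ->.
have gh := composable_cover_map sr; split=> //.
have [u [v zg]] := Ghat_Zc phi; have [v' [w zh]] := Ghat_Zc psi.
have [u'' [w'' [_ ZM]]] := Z_mul u v v' w.
have FZp := (tends_indZ u v FF tp).1 ((Z_cover_map phi u v).1 zg).
have FZq := (tends_indZ v' w FF tq).1 ((Z_cover_map psi v' w).1 zh).
pose m i := GX_mul (p i) (q i).
have FZm : F (m @^-1` Z u'' w'').
  by apply: filterS (filterI (filterI FZp FZq) Fpq) => i [[/= zp zq] pq]; exact: ZM.
have tm : tends F (gsource \o m) (hsrc psi).
  apply: tends_near_eq (hsrc_tends tq).
  by apply: filterS Fpq => i /= /GX_mulE[].
have [xi [txi sxi]] := ghat_exists FZm tm.
exists xi; split=> //.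
- apply: (cover_map_unique FF txi).
  have FF1 : Filter (m @ F) by exact: fmap_filter.
  apply: (@cvg_GX _ FF1) => a b /(GX_mul_continuous gh)[u1 [v1 [u2 [v2 [z1 z2 H]]]]].
  have F1 := (tends_indZ u1 v1 FF tp).1 ((Z_cover_map phi u1 v1).1 z1).
  have F2 := (tends_indZ u2 v2 FF tq).1 ((Z_cover_map psi u2 v2).1 z2).
  have : F (m @^-1` Z a b); last by [].
  by apply: filterS (filterI (filterI F1 F2) Fpq) => i [[/= zp zq] pq]; exact: H.
- apply: (tends_unique FF (hrng_tends txi)).
  apply: tends_near_eq (hrng_tends tp).
  by apply: filterS Fpq => i /= /GX_mulE[].
Qed.

(** The product is specified by its two coordinates, which determine it by [Ghat_eq]; for composable
    pairs [mul_exists] supplies it, so the default is not taken. *)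
Definition hmul (phi psi : Ghat R) : Ghat R :=
  xget phi [set xi | cover_map xi = GX_mul (cover_map phi) (cover_map psi) /\
                     hsrc xi = hsrc psi].

Lemma hmul_unique (phi psi xi : Ghat R) :
  cover_map xi = GX_mul (cover_map phi) (cover_map psi) -> hsrc xi = hsrc psi ->
  hmul phi psi = xi.
Proof.
move=> c s; rewrite /hmul; case: xgetP => [xi' _ [c' s']|/(_ xi)[]//].
by apply: Ghat_eq; rewrite ?c ?s.
Qed.

Lemma hmul_tends (I : Type) (F : set_system I) (p q : I -> GX) (phi psi : Ghat R) :
  ProperFilter F -> tends F p phi -> tends F q psi ->
  F [set i | gsource (p i) = grange (q i)] ->
  tends F (fun i => GX_mul (p i) (q i)) (hmul phi psi).
Proof.
move=> FF tp tq Fpq; have [_ [xi [txi c s _]]] := mul_exists FF tp tq Fpq.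
by rewrite (hmul_unique c s).
Qed.

Lemma hmulP (phi psi : Ghat R) : hsrc phi = hrng psi ->
  [/\ cover_map (hmul phi psi) = GX_mul (cover_map phi) (cover_map psi),
      hsrc (hmul phi psi) = hsrc psi & hrng (hmul phi psi) = hrng phi].
Proof.
move=> sr; have FP := near_filter_A psi; have tn := tends_nearA psi.
have [p [tp Fp]] := composable_tends sr.
by have [_ [xi [txi c s r]]] := mul_exists FP tp tn Fp; rewrite (hmul_unique c s).
Qed.

Definition cover_groupoid : groupoid_ops (Xhat R) (Ghat R) :=
  GroupoidOps hsrc hrng hunit hinv hmul.

Lemma cover_groupoid_is_groupoid : is_groupoid cover_groupoid.
Proof.
have GG := GX_is_groupoid.
split => /=.
- exact: hsrc_hunit.
- exact: hrng_hunit.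
- by move=> g h /hmulP[].
- by move=> g h /hmulP[].
- move=> g h k gh hk.
  have [c1 s1 r1] := hmulP gh; have [c2 s2 r2] := hmulP hk.
  have [c3 s3 r3] := @hmulP (hmul g h) k (etrans s1 hk).
  have [c4 s4 r4] := @hmulP g (hmul h k) (etrans gh (esym r2)).
  apply: Ghat_eq; rewrite ?s3 ?s4 ?s2 // c3 c4 c1 c2.
  exact: (mul_assoc GG (composable_cover_map gh) (composable_cover_map hk)).
- move=> g; have [c s r] := @hmulP (hunit (hrng g)) g (hsrc_hunit _).
  apply: Ghat_eq; rewrite ?s // c cover_hunit_hrng; exact: (mul_unitl GG).
- move=> g; have [c s r] := @hmulP g (hunit (hsrc g)) (esym (hrng_hunit _)).
  apply: Ghat_eq; rewrite ?s ?hsrc_hunit // c cover_hunit_hsrc; exact: (mul_unitr GG).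
- exact: hsrc_hinv.
- exact: hrng_hinv.
- move=> g; have [c s r] := @hmulP (hinv g) g (hsrc_hinv _).
  apply: Ghat_eq; rewrite ?s ?hsrc_hunit // c cover_hunit_hsrc cover_hinv.
  exact: (mul_invl GG).
- move=> g; have [c s r] := @hmulP g (hinv g) (esym (hrng_hinv _)).
  apply: Ghat_eq; rewrite ?s ?hsrc_hunit ?hsrc_hinv // c cover_hunit_hrng cover_hinv.
  exact: (mul_invr GG).
Qed.

(** * Continuity of the operations *)

Lemma app_hinv (phi : Ghat R) a : A a -> app (hinv phi) a = app phi (a \o GX_inv).
Proof.
move=> Aa; have FP := near_filter_A phi; have tn := tends_nearA phi.
exact: (Cx_cvg_unique FP (hinv_tends tn Aa) (tn _ (Aalg_inv Aa))).
Qed.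

Lemma app_hunit (chi : Xhat R) a : A a -> app (hunit chi) a = app chi (a \o GX_unit).
Proof.
move=> Aa; have FP := near_filter_D chi; have tn := tends_nearD chi.
exact: (Cx_cvg_unique FP (hunit_tends tn Aa) (tn _ (Dalg_unit Aa))).
Qed.

Lemma app_hsrc (phi : Ghat R) u v d : D d -> app phi (indZ u v) = 1 ->
  app (hsrc phi) d = app phi (fun g => indZ u v g * d (gsource g)).
Proof.
move=> Dd E; have FP := near_filter_A phi; have tn := tends_nearA phi.
apply: (Cx_cvg_unique FP (hsrc_tends tn Dd)).
apply: (tends_local (a := d \o gsource) _ tn ((tends_indZ u v FP tn).1 E)).
exact: (Aalg_gen (@indC_Z_Cc R u v) Dd).
Qed.

Lemma nbhs_indZ (phi : Ghat R) u v : app phi (indZ u v) = 1 ->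
  nbhs phi [set psi : Ghat R | app psi (indZ u v) = 1].
Proof.
move=> E; have H : (fun q : Ghat R => app q (indZ u v)) @ phi --> (1 : C).
  by rewrite -E; exact: (app_continuous (@indZ_A R u v)).
have N1 : nbhs phi [set psi : Ghat R | app psi (indZ u v) != 0].
  by apply: (cvgr_neq0 _ H); exact: oner_neq0.
apply: filterS N1 => psi /=; have [-> //|->] := app_indZ_or psi u v.
by rewrite eqxx.
Qed.

Lemma open_indZ u v : open [set psi : Ghat R | app psi (indZ u v) = 1].
Proof. by rewrite openE => psi; exact: nbhs_indZ. Qed.

Lemma hsrc_continuous : continuous hsrc.
Proof.
move=> phi; have [u [v E]] := Ghat_Z phi.
have FF : Filter (nbhs phi) by exact: nbhs_filter.
apply: cvg_spectrum => d Dd; rewrite (app_hsrc Dd E).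
have Ad := Aalg_gen (@indC_Z_Cc R u v) Dd.
apply: cvg_trans (app_continuous Ad (x := phi)); apply: near_eq_cvg.
by apply: filterS (nbhs_indZ E) => psi E'; rewrite (app_hsrc Dd E').
Qed.

Lemma hinv_continuous : continuous hinv.
Proof.
apply: spectrum_continuousP => a Aa.
have -> : (fun phi => app (hinv phi) a) = (fun phi => app phi (a \o GX_inv)).
  by apply: funext => phi; rewrite app_hinv.
by apply: app_continuous; exact: Aalg_inv.
Qed.

Lemma hrng_continuous : continuous hrng.
Proof.
have -> : hrng = hsrc \o hinv by apply: funext => phi; rewrite /= hsrc_hinv.
by move=> phi; apply: continuous_comp; [exact: hinv_continuous|exact: hsrc_continuous].
Qed.

Lemma hunit_continuous : continuous hunit.
Proof.
apply: spectrum_continuousP => a Aa.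
have -> : (fun chi => app (hunit chi) a) = (fun chi => app chi (a \o GX_unit)).
  by apply: funext => chi; rewrite app_hunit.
by apply: app_continuous; exact: Dalg_unit.
Qed.

(** For factors in fixed bisections the product stays in the bisection [Z u'' w''] and has the
    source of the right factor. By [app_push] its coordinates are then continuous functions of that
    source alone. *)
Lemma hmul_continuous :
  {within composable cover_groupoid, continuous (fun p : Ghat R * Ghat R => hmul p.1 p.2)}.
Proof.
apply/subspace_continuousP => -[phi psi] /= sr.
have [u [v zg]] := Ghat_Zc phi; have [v' [w zh]] := Ghat_Zc psi.
have [u'' [w'' [_ ZM]]] := Z_mul u v v' w.
have H a (phi' psi' : Ghat R) : A a -> hsrc phi' = hrng psi' ->
    app phi' (indZ u v) = 1 -> app psi' (indZ v' w) = 1 ->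
    app (hmul phi' psi') a = app (hsrc psi') (push u'' w'' a).
  move=> Aa sr' /Z_cover_map E1 /Z_cover_map E2.
  have [c s _] := hmulP sr'.
  rewrite (@app_push R _ u'' w'') ?s //; apply/Z_cover_map; rewrite c.
  by apply: ZM => //; exact: composable_cover_map.
have E1 := (Z_cover_map phi u v).1 zg; have E2 := (Z_cover_map psi v' w).1 zh.
apply: cvg_spectrum => a Aa; rewrite /= (H a phi psi) //.
have cq : (fun p : Ghat R * Ghat R => app (hsrc p.2) (push u'' w'' a)) @ nbhs (phi, psi) -->
    app (hsrc psi) (push u'' w'' a).
  apply: (@cvg_comp _ _ _ snd (fun q => app (hsrc q) (push u'' w'' a))); first exact: cvg_snd.
  apply: (@cvg_comp _ _ _ hsrc (fun q => app q (push u'' w'' a))); first exact: hsrc_continuous.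
  exact: (app_continuous (Dalg_push u'' w'' Aa)).
apply: cvg_trans (cvg_trans (cvg_app _ (@cvg_within _ (nbhs (phi, psi)) _ (composable cover_groupoid))) cq).
apply: near_eq_cvg; rewrite /within /=.
have N1 : nbhs (phi, psi) [set p : Ghat R * Ghat R | app p.1 (indZ u v) = 1].
  exact: (@cvg_fst _ _ (nbhs phi) (nbhs psi) _ _ (nbhs_indZ E1)).
have N2 : nbhs (phi, psi) [set p : Ghat R * Ghat R | app p.2 (indZ v' w) = 1].
  exact: (@cvg_snd _ _ (nbhs phi) (nbhs psi) _ _ (nbhs_indZ E2)).
by apply: filterS (filterI N1 N2) => -[p q] /= [h1 h2] h3; rewrite (H a p q).
Qed.

Lemma cover_groupoid_continuous : continuous_ops cover_groupoid.
Proof.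
split; [exact: hsrc_continuous|exact: hrng_continuous|exact: hunit_continuous|
        exact: hinv_continuous|exact: hmul_continuous].
Qed.

(** * Source and range as local homeomorphisms *)

Lemma hsrc_section (chi : Xhat R) u v : app chi (push u v (indZ u v)) != 0 ->
  exists2 phi : Ghat R, app phi (indZ u v) = 1 & hsrc phi = chi.
Proof.
move=> E; have FP := near_filter_D chi; have tn := tends_nearD chi.
have H := tn _ (Dalg_push u v (@indZ_A R u v)).
have F1 : near_filter chi [set y | push u v (indZ u v) y != 0].
  by apply: (cvgr_neq0 _ H).
have Fd : near_filter chi (gsource @` Z u v).
  apply: filterS F1 => y /= y0; apply: contrapT => ny.
  by move: y0; rewrite push_out ?eqxx.
have FZ : near_filter chi (src_section u v @^-1` Z u v) by apply: filterS Fd => h /src_sectionP[].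
have tp : tends (near_filter chi) (gsource \o src_section u v) chi.
  by apply: tends_near_eq tn; apply: filterS Fd => h /src_sectionP[].
have [xi [txi sxi]] := ghat_exists FZ tp.
by exists xi => //; exact/(tends_indZ _ _ FP txi).
Qed.

(** [P] is the indicator of the source image of [Z u v]. Since it belongs to [D], the image of [W]
    is the open set where [P] does not vanish, although below the source image need not be open. The
    inverse is continuous because [app_push] computes an arrow of [W] from its source. *)
Lemma hsrc_local_homeomorphism : local_homeomorphism hsrc.
Proof.
move=> phi; have [u [v E]] := Ghat_Z phi.
pose W := [set psi : Ghat R | app psi (indZ u v) = 1].
pose P := push u v (indZ u v).
have DP : D P by apply: Dalg_push; exact: indZ_A.
have imW : hsrc @` W = [set chi : Xhat R | app chi P != 0].
  apply/seteqP; split=> [_ [psi Wpsi <-]|chi /= /hsrc_section[psi Epsi <-]].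
    by rewrite /= -app_push ?Wpsi ?oner_neq0 //; exact: indZ_A.
  by exists psi.
pose f' (chi : Xhat R) := xget (hunit chi) [set psi | W psi /\ hsrc psi = chi].
have f'P psi : W psi -> f' (hsrc psi) = psi.
  move=> Wpsi; rewrite /f'; case: xgetP => [psi' _ [W' s']|/(_ psi)[]//].
  exact: Ghat_eq_local W' Wpsi s'.
exists W; split; [exact: open_indZ|exact: E| | |].
- rewrite imW openE => chi /= chi0.
  by apply: (cvgr_neq0 _ (app_continuous DP (x := chi))).
- exact/continuous_subspaceT/hsrc_continuous.
exists f' => //; apply/subspace_continuousP => _ [psi Wpsi <-].
have key : f' @ within (hsrc @` W) (nbhs (hsrc psi)) --> f' (hsrc psi); last exact: key.
apply: cvg_spectrum => a Aa; rewrite (f'P _ Wpsi) (app_push Aa Wpsi).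
have Dp := Dalg_push u v Aa.
apply: cvg_trans (cvg_trans (cvg_app _ (@cvg_within _ (nbhs (hsrc psi)) _ (hsrc @` W)))
  (app_continuous Dp (x := hsrc psi))).
apply: near_eq_cvg.
have FN : Filter (nbhs (hsrc psi)) by exact: nbhs_filter.
have H : nbhs (hsrc psi) [set chi | (hsrc @` W) chi ->
    app chi (push u v a) = app (f' chi) a].
  by apply: filterE => _ [xi Wxi <-]; rewrite (f'P _ Wxi) (app_push Aa Wxi).
exact: H.
Qed.

Lemma hrng_local_homeomorphism : local_homeomorphism hrng.
Proof.
have hinvK : involutive hinv.
  move=> phi; apply: Ghat_eq; first by rewrite !cover_hinv GX_invK.
  by rewrite hsrc_hinv hrng_hinv.
move=> phi; have [W [oW Wphi oim _ [f' cf' f'K]]] := hsrc_local_homeomorphism (hinv phi).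
have imE : hrng @` (hinv @^-1` W) = hsrc @` W.
  apply/seteqP; split=> [_ [psi Wpsi <-]|_ [psi Wpsi <-]].
    by exists (hinv psi) => //; rewrite hsrc_hinv.
  by exists (hinv psi); rewrite /= ?hinvK ?hrng_hinv.
exists (hinv @^-1` W); split=> //.
- by apply: open_comp => // psi _; exact: hinv_continuous.
- by rewrite imE.
- exact/continuous_subspaceT/hrng_continuous.
exists (hinv \o f').
  rewrite imE; apply: (@within_continuous_comp _ _ _ _ f' hinv) => // psi _.
  exact: hinv_continuous.
by move=> psi Wpsi; rewrite /= -hsrc_hinv f'K // hinvK.
Qed.

Lemma Ghat_locally_compact : locally_compact [set: Ghat R].
Proof.
move=> phi _; have [u [v E]] := Ghat_Z phi.
have cO := spectrum_compact cA (@indZ_A R u v).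
exists [set psi : Ghat R | app psi (indZ u v) = 1].
  by apply: filterS (nbhs_indZ E) => psi.
split=> //; apply: compact_closed => //; exact: spectrum_hausdorff.
Qed.

Lemma cover_groupoid_etale : etale_groupoid cover_groupoid.
Proof.
split; [exact: cover_groupoid_is_groupoid|exact: cover_groupoid_continuous|exact: spectrum_hausdorff|
  exact: Ghat_locally_compact|exact: hsrc_local_homeomorphism|exact: hrng_local_homeomorphism].
Qed.

Lemma is_evaluation_tendsP (T : Type) (B : set (T -> C)) t (phi : spectrum B) :
  is_evaluation t phi <-> tends (principal_filter tt) (fun=> t) phi.
Proof.
have FF : ProperFilter (principal_filter tt) := @ultra_proper _ _ (principal_filter_ultra tt).
by split; [exact: is_evaluation_tends|exact: tends_is_evaluation].
Qed.

Lemma cover_groupoid_extension : continuous_extension cover_groupoid.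
Proof.
have FF : ProperFilter (principal_filter tt) := @ultra_proper _ _ (principal_filter_ultra tt).
split; first exact: cover_groupoid_continuous.
- move=> g phi /is_evaluation_tendsP H; apply/is_evaluation_tendsP.
  exact: (hsrc_tends H).
- move=> g phi /is_evaluation_tendsP H; apply/is_evaluation_tendsP.
  exact: (hrng_tends H).
- move=> x chi /is_evaluation_tendsP H; apply/is_evaluation_tendsP.
  exact: (hunit_tends H).
- move=> g phi /is_evaluation_tendsP H; apply/is_evaluation_tendsP.
  exact: (hinv_tends H).
- move=> g h phi psi gh /is_evaluation_tendsP H1 /is_evaluation_tendsP H2.
  apply/is_evaluation_tendsP; apply: (hmul_tends FF H1 H2).
  exact: filterE.
Qed.

(** * Uniqueness of the continuous extension *)

Lemma evalX_exists (x : X) : exists chi : Xhat R, is_evaluation x chi.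
Proof.
apply: evaluation_exists; exists (fun=> 1); [exact: Dalg1|exact: oner_neq0].
Qed.

Lemma evalG_exists (g : GX) : exists phi : Ghat R, is_evaluation g phi.
Proof.
have [u [v [zg _]]] := Z_extend g 0.
apply: evaluation_exists; exists (indZ u v); first exact: indZ_A.
by rewrite indC1 // oner_neq0.
Qed.

Definition evalX x : Xhat R := sval (cid (evalX_exists x)).
Definition evalG g : Ghat R := sval (cid (evalG_exists g)).

Lemma evalXP x : is_evaluation x (evalX x).
Proof. by rewrite /evalX; case: cid. Qed.

Lemma evalGP g : is_evaluation g (evalG g).
Proof. by rewrite /evalG; case: cid. Qed.

Lemma cvg_evalX (I : Type) (F : set_system I) (k : I -> X) chi : Filter F ->
  tends F k chi -> (fun i => evalX (k i)) @ F --> chi.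
Proof.
move=> FF H; apply: cvg_spectrum => f Df; have := H f Df.
apply: cvg_trans; apply: near_eq_cvg; apply: filterE => i /=.
by rewrite ((is_evaluationP _ _).1 (evalXP _)).
Qed.

Lemma cvg_evalG (I : Type) (F : set_system I) (k : I -> GX) phi : Filter F ->
  tends F k phi -> (fun i => evalG (k i)) @ F --> phi.
Proof.
move=> FF H; apply: cvg_spectrum => f Af; have := H f Af.
apply: cvg_trans; apply: near_eq_cvg; apply: filterE => i /=.
by rewrite ((is_evaluationP _ _).1 (evalGP _)).
Qed.

Lemma cvg_tends (T : Type) (B : set (T -> C)) (I : Type) (F : set_system I)
    (theta : I -> spectrum B) (k : I -> T) (phi : spectrum B) : Filter F ->
  F [set i | is_evaluation (k i) (theta i)] -> theta @ F --> phi -> tends F k phi.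
Proof.
move=> FF Fk Ftheta f Bf.
have H : (fun i => app (theta i) f) @ F --> app phi f.
  by move=> N /(app_continuous Bf) nN; exact: (Ftheta _ nN).
apply: cvg_trans H; apply: near_eq_cvg; apply: filterS Fk => i /is_evaluationP H.
by rewrite /= H.
Qed.

(** Evaluations at the points of [near_filter phi] converge to [phi], so continuity leaves no
    freedom. For the product the approximating pairs must themselves be composable, as continuity
    holds only within composable pairs; [composable_tends] provides such pairs. *)
Lemma extension_unique (G' : groupoid_ops (Xhat R) (Ghat R)) :
  continuous_extension G' -> same_groupoid cover_groupoid G'.
Proof.
move=> [[cs cr cu ci cm] es er eu ei em].
have src' : hsrc =1 gsrc G'.
  move=> phi; have FP := near_filter_A phi; have tn := tends_nearA phi.
  apply: (tends_unique FP (hsrc_tends tn)).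
  apply: (@cvg_tends _ _ _ _ (gsrc G' \o evalG)).
    by apply: filterE => g /=; apply: es; exact: evalGP.
  exact: cvg_comp (cvg_evalG _ tn) (cs phi).
have rng' : hrng =1 grng G'.
  move=> phi; have FP := near_filter_A phi; have tn := tends_nearA phi.
  apply: (tends_unique FP (hrng_tends tn)).
  apply: (@cvg_tends _ _ _ _ (grng G' \o evalG)).
    by apply: filterE => g /=; apply: er; exact: evalGP.
  exact: cvg_comp (cvg_evalG _ tn) (cr phi).
split=> //=.
- move=> chi; have FP := near_filter_D chi; have tn := tends_nearD chi.
  apply: (tends_unique FP (hunit_tends tn)).
  apply: (@cvg_tends _ _ _ _ (gunit G' \o evalX)).
    by apply: filterE => g /=; apply: eu; exact: evalXP.
  exact: cvg_comp (cvg_evalX _ tn) (cu chi).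
- move=> phi; have FP := near_filter_A phi; have tn := tends_nearA phi.
  apply: (tends_unique FP (hinv_tends tn)).
  apply: (@cvg_tends _ _ _ _ (ginv G' \o evalG)).
    by apply: filterE => g /=; apply: ei; exact: evalGP.
  exact: cvg_comp (cvg_evalG _ tn) (ci phi).
suff H (phi psi : Ghat R) : hsrc phi = hrng psi -> hmul phi psi = gmul G' phi psi.
  by case=> phi psi; exact: H.
move=> sr; have FP := near_filter_A psi; have tn := tends_nearA psi.
have [p [tp Fp]] := composable_tends sr.
apply: (tends_unique FP (hmul_tends FP tp tn Fp)).
apply: (@cvg_tends _ _ _ _ (fun h => gmul G' (evalG (p h)) (evalG h))).
  by apply: filterS Fp => h /= ph; apply: em => //; exact: evalGP.
have sr' : composable G' (phi, psi) by rewrite /composable /= -src' -rng'.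
have cm' : (fun p => gmul G' p.1 p.2) @ within (composable G') (nbhs ((phi, psi) : Ghat R * Ghat R)) -->
    gmul G' phi psi by move/subspace_continuousP/(_ _ sr'): cm.
move=> N nN.
have wN : nbhs ((phi, psi) : Ghat R * Ghat R) [set p | composable G' p -> N (gmul G' p.1 p.2)] := cm' N nN.
have cN : (fun h => (evalG (p h), evalG h)) @ near_filter psi --> ((phi, psi) : Ghat R * Ghat R).
  by apply: (cvg_pair (cvg_evalG _ tp) (cvg_evalG _ tn)).
apply: filterS (filterI Fp (cN _ wN)) => h [/= ph]; apply.
rewrite /composable /=.
exact: (is_evaluation_unique (es _ _ (evalGP _)) (eq_rect_r (fun x => is_evaluation x _)
  (er _ _ (evalGP h)) ph)).
Qed.

End CoverGroupoid.

(** * Lengths, words and primes *)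

Section Length.
Local Open Scope ring_scope.

(** The pair of exponents is kept explicit because [ell g] is the least [m + n] over all lags of
    [g], as [ell_le] and [ell_lag] show together. *)
Definition lag (g : GX) (m n : nat) : Prop :=
  gdeg g = m%:Z - n%:Z /\ iter m shift (grange g) = iter n shift (gsource g).

Lemma lag_Spow m n g : lag g m n -> Spow (m + n) g.
Proof.
case; elim: m g => [|m IHm] g.
  elim: n g => [|n IHn] g dg /= Eg.
    by exists (grange g) => //; apply: GX_eq.
  have p1 : exists p q : nat, (-1 : int) = p%:Z - q%:Z /\
    iter p shift (grange g) = iter q shift (iter n shift (gsource g)).
    by exists 0%N, 1%N.
  have p2 : exists p q : nat, (- n%:Z : int) = p%:Z - q%:Z /\
    iter p shift (iter n shift (gsource g)) = iter q shift (gsource g).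
    by exists 0%N, n; rewrite sub0r.
  exists (MkGX p1), (MkGX p2); split=> //=.
  - by exists (letters (iter n shift (gsource g)) 0) => //; right; split.
  - by apply: IHn; rewrite //= sub0r.
  - have [r d s] := @GX_mulE (MkGX p1) (MkGX p2) erefl.
    by apply: GX_eq; rewrite ?r ?d ?s //= dg; lia.
move=> dg Eg.
have p1 : exists p q : nat, (1 : int) = p%:Z - q%:Z /\
  iter p shift (grange g) = iter q shift (shift (grange g)).
  by exists 1%N, 0%N.
have E2 : iter m shift (shift (grange g)) = iter n shift (gsource g).
  by rewrite -iterSr.
have p2 : exists p q : nat, (m%:Z - n%:Z : int) = p%:Z - q%:Z /\
  iter p shift (shift (grange g)) = iter q shift (gsource g).
  by exists m, n.
exists (MkGX p1), (MkGX p2); split=> //=.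
- by exists (letters (grange g) 0) => //; left; split.
- exact: IHm.
- have [r d s] := @GX_mulE (MkGX p1) (MkGX p2) erefl.
  by apply: GX_eq; rewrite ?r ?d ?s //= dg; lia.
Qed.

(** A generator on the left changes a lag by one unit: in degree 1 it raises [m]; in degree -1 it
    lowers [m], or raises [n] when [m] is already 0. *)
Lemma Spow_lag k g : Spow k g -> exists m n, (m + n <= k)%N /\ lag g m n.
Proof.
elim: k g => [|k IH] g /=.
  by case=> x _ <-; exists 0%N, 0%N; split=> //; split=> //=; rewrite subrr.
case=> a [b [Sa /IH[m [n [le [db Eb]]]] ab ->]]; have [r d s] := GX_mulE ab.
case: Sa => c _ [[_ _ /= da Ea]|[_ _ /= da Ea]].
  exists m.+1, n; split; first by lia.
  split; first by rewrite d da db; lia.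
  by rewrite r s iterSr Ea ab Eb.
case: m le db Eb => [|m] le db /= Eb.
  exists 0%N, n.+1; split; first by lia.
  split; first by rewrite d da db; lia.
  by rewrite r s /= Ea ab Eb.
exists m, n; split; first by lia.
split; first by rewrite d da db; lia.
by rewrite r s Ea ab -Eb -iterSr.
Qed.

Lemma lag0_unit g : lag g 0 0 -> range GX_unit g.
Proof. by case=> d /= E; exists (grange g) => //; apply: GX_eq. Qed.

Lemma ell_le g m n : lag g m n -> (ell g <= m + n)%N.
Proof.
move=> gmn; rewrite /ell; case: asboolP => // ng.
case: ex_minnP => k _; apply; apply/andP; split; last exact/asboolP/lag_Spow.
(* The minimum in [ell] runs over positive exponents only, so a lag with [m + n = 0] has to be
   recognised as a unit. *)
rewrite lt0n; apply/eqP => mn0; apply: ng; apply: lag0_unit.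
have [m0 n0] : m = 0%N /\ n = 0%N by lia.
by move: gmn; rewrite m0 n0.
Qed.

Lemma ell_lag g : exists m n, (m + n)%N = ell g /\ lag g m n.
Proof.
suff [m [n [le gmn]]] : exists m n, (m + n <= ell g)%N /\ lag g m n.
  by exists m, n; split=> //; apply/eqP; rewrite eqn_leq le ell_le.
rewrite /ell; case: asboolP => [[x _ <-]|ng].
  by exists 0%N, 0%N; split=> //; split=> //=; rewrite subrr.
by case: ex_minnP => k /andP[_ /asboolP/Spow_lag].
Qed.

Lemma ell_unit x : ell (GX_unit x) = 0%N.
Proof.
by apply/eqP; rewrite -leqn0; apply: (@ell_le _ 0 0); split=> //=; rewrite subrr.
Qed.

Lemma ell_inv g : ell (GX_inv g) = ell g.
Proof.
have H h : (ell (GX_inv h) <= ell h)%N.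
  have [m [n [<- [d E]]]] := ell_lag h; rewrite addnC; apply: ell_le.
  by split; rewrite /= ?d ?opprB.
by apply/eqP; rewrite eqn_leq H -{1}(GX_invK g) H.
Qed.

Lemma ell_mul g h : gsource g = grange h -> (ell (GX_mul g h) <= ell g + ell h)%N.
Proof.
move=> gh; have [r d s] := GX_mulE gh.
have [m [n [<- [dg Eg]]]] := ell_lag g; have [p [q [<- [dh Eh]]]] := ell_lag h.
have -> : (m + n + (p + q) = (p + m) + (n + q))%N by lia.
apply: ell_le; split; first by rewrite d dg dh; lia.
by rewrite r s iterD Eg gh -iterD addnC iterD Eh -iterD.
Qed.

Lemma Z_lag u v g : Z u v g -> lag g (size u) (size v).
Proof. by case. Qed.

End Length.

(** * Gaps between ones and points with finitely many ones *)

Section Words.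
Local Open Scope nat_scope.

Definition occ (w : seq bool) (x : nat -> bool) (i : nat) : Prop :=
  forall l, l < size w -> x (i + l) = nth false w l.

Lemma occursP w x : occurs w x <-> exists i, occ w x i.
Proof.
split=> -[i H]; exists i.
  by move=> l lw; rewrite -[in RHS]H nth_mkseq.
apply: (@eq_from_nth _ false); rewrite size_mkseq // => l lw.
by rewrite nth_mkseq // H.
Qed.

Lemma occ_cat w1 w2 x i : occ (w1 ++ w2) x i <-> occ w1 x i /\ occ w2 x (i + size w1).
Proof.
rewrite /occ size_cat; split=> [H|[H1 H2] l lw].
  split=> l lw; first by rewrite H ?nth_cat ?lw //; lia.
  rewrite -addnA H; last by lia.
  by rewrite nth_cat ifF; [congr nth; lia|lia].
rewrite nth_cat; case: ifPn => l1; first exact: H1.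
by rewrite -H2; [congr x; lia|lia].
Qed.

Lemma gap_word_cons n ns : gap_word (n :: ns) = true :: nseq n false ++ gap_word ns.
Proof. by rewrite /gap_word /= cat_rcons. Qed.

Lemma occ_gap_nil x i : occ (gap_word [::]) x i <-> x i.
Proof.
split=> [/(_ 0 isT)|H [|//] _]; by rewrite addn0 //= => ->.
Qed.

Lemma occ_gap_cons n ns x i : occ (gap_word (n :: ns)) x i <->
  [/\ x i, forall l, l < n -> x (i.+1 + l) = false & occ (gap_word ns) x (i + n.+1)].
Proof.
rewrite gap_word_cons -cat1s occ_cat occ_cat size_nseq /=.
rewrite (_ : i + 1 + n = i + n.+1); last by lia.
rewrite -[[:: true]]/(gap_word [::]) occ_gap_nil.
split=> [[xi [H1 H2]]|[xi H1 H2]]; split=> //.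
  move=> l ln; have := H1 l; rewrite size_nseq => /(_ ln).
  by rewrite nth_nseq ln addn1.
split=> // l; rewrite size_nseq => ln; rewrite nth_nseq ln addn1; exact: H1.
Qed.

Lemma occ_gap_head ns x i : occ (gap_word ns) x i -> x i.
Proof. by case: ns => [|n ns]; [move/occ_gap_nil|case/occ_gap_cons]. Qed.

Lemma X_not_occ (x : X) w i : forbidden w -> ~ occ w (letters x) i.
Proof.
move=> Fw H; apply: (set_mem (valP x) w Fw); apply/occursP; by exists i.
Qed.

Lemma X_gap (x : X) i n : letters x i ->
  (forall l, l < n -> letters x (i.+1 + l) = false) -> letters x (i + n.+1) -> prime n.
Proof.
move=> xi x0 xn; apply: contrapT => /negP pn.
apply: (@X_not_occ x (gap_word [:: n]) i); first by left; exists n.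
by apply/occ_gap_cons; split=> //; apply/occ_gap_nil.
Qed.

Lemma X_gap_lt (x : X) i n m : letters x i ->
  (forall l, l < n -> letters x (i.+1 + l) = false) -> letters x (i + n.+1) ->
  (forall l, l < m -> letters x ((i + n.+1).+1 + l) = false) ->
  letters x (i + n.+1 + m.+1) -> n < m.
Proof.
move=> xi x0 xn x1 xm; rewrite ltnNge; apply/negP => mn.
apply: (@X_not_occ x (gap_word [:: n; m]) i).
  right; exists [:: n; m]; split=> //=; last by exists 0.
  by rewrite (X_gap xi x0 xn) (X_gap xn x1 xm).
apply/occ_gap_cons; split=> //; apply/occ_gap_cons; split=> //.
exact/occ_gap_nil.
Qed.

(** Here [i] is the last one before [j], and the letter at [j] itself is left free. *)
Lemma last_one (b : nat -> bool) j : count b (iota 0 j) = 0 \/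
  exists i n, [/\ j = i + n.+1, b i, forall l, l < n -> b (i.+1 + l) = false &
    count b (iota 0 j) = (count b (iota 0 i)).+1].
Proof.
elim: j => [|j IH]; first by left.
rewrite -{1 3}addn1 iotaD count_cat /= add0n addn0.
have [bj|bj] := boolP (b j).
  by right; exists j, 0; split=> //; rewrite addn1.
rewrite addn0; case: IH => [->|[i [n [jE bi b0 cj]]]]; first by left.
right; exists i, n.+1; split=> //; first by lia.
move=> l; rewrite ltnS leq_eqVlt => /predU1P[->|/b0//].
by rewrite addSn -addnS -jE; exact: (negbTE bj).
Qed.

(* The gaps between ones increase, so the [r]-th gap has length at least [r]. *)
Lemma ones_before (x : X) j : letters x j ->
  let c k := count (letters x) (iota 0 k) in
  c j * (c j).+1 <= j.*2 /\
  (c j = 0 \/ exists i n, [/\ j = i + n.+1, letters x i,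
    forall l, l < n -> letters x (i.+1 + l) = false & c j <= n.+1]).
Proof.
move=> + c; elim/ltn_ind: j => j IH xj.
have [c0|[i [n [jE xi x0 cj]]]] := last_one (letters x) j.
  by rewrite /c c0; split => //; left.
have [|ci prev] := IH i _ xi; first by rewrite jE; lia.
have cn : c j <= n.+1.
  have cjE : c j = (c i).+1 := cj.
  rewrite cjE ltnS; case: prev => [->//|[i' [n' [iE xi' x0' cn']]]].
  apply: (leq_trans cn'); subst i j; exact: (@X_gap_lt x i' n' n).
split; last by right; exists i, n.
(* Adding [c i * c j <= 2 * i] to [2 * c j <= 2 * (j - i)] gives the bound at [j], as
   [c j = c i + 1]. *)
have cjE : c j = (c i).+1 by [].
by move: ci cn; rewrite cjE jE -!muln2; nia.
Qed.

(** The predecessor discards the last one before [m], at whose position [ones_before] applies. *)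
Lemma ones_bound (x : X) m : (count (letters x) (iota 0 m)).-1 ^ 2 <= 2 * m.
Proof.
have [->//|[i [n [-> xi x0 ->]]]] := last_one (letters x) m.
by have /= [] := ones_before xi; rewrite -muln2; nia.
Qed.

(** The default of [nth] continues the word with zeros, so these points all reach [Xzero] after
    finitely many shifts. *)
Definition gap_seq (s : seq nat) (n : nat) : bool := nth false (gap_word s) n.

Lemma gap_seq_cons p s n : gap_seq (p :: s) n =
  if n == 0 then true else if n <= p then false else gap_seq s (n - p.+1).
Proof.
rewrite /gap_seq gap_word_cons; case: n => //= n.
rewrite nth_cat size_nseq nth_nseq; case: ltnP => // _; by rewrite subSS.
Qed.

(** A gap word has to start at a one. At position 0 its first gap and the head of [s] end at the
    same next one, hence agree; at any other position the head of [s] is skipped. The clause for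
    [k = 0] carries the induction and later gives injectivity. *)
Lemma occ_gap_seq ns s k : occ (gap_word ns) (gap_seq s) k ->
  exists s1 s2, s = s1 ++ ns ++ s2 /\ (k = 0 -> s1 = [::]).
Proof.
elim: s ns k => [|p s IH] [|n ns] k.
- by exists [::], [::].
- case/occ_gap_cons; case: k => [|k]; last by rewrite /gap_seq /= nth_nil.
  by move=> _ _ /occ_gap_head; rewrite /gap_seq /= nth_nil.
- by exists [::], (p :: s).
have shift w i : occ w (gap_seq (p :: s)) (i + p.+1) -> occ w (gap_seq s) i.
  move=> H l lw; rewrite -H // gap_seq_cons.
  by rewrite ifF ?ifF; [congr gap_seq; lia|lia|lia].
have [->|k0] := eqVneq k 0.
  case/occ_gap_cons => _ z0; rewrite add0n => o1.
  have np : n = p.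
    have := occ_gap_head o1; rewrite gap_seq_cons /=; case: leqP => // pn _.
    apply/eqP; rewrite eqn_leq pn andbT leqNgt; apply/negP => pn'.
    by have := z0 p pn'; rewrite gap_seq_cons /= add1n ltnn subnn.
  subst n; have [s1 [s2 [-> s10]]] := IH ns 0 (@shift _ 0 o1).
  by exists [::], s2; rewrite (s10 erefl).
move=> o1; have := occ_gap_head o1; rewrite gap_seq_cons (negbTE k0).
case: leqP => // pk _.
rewrite -(subnK pk) in o1; have [s1 [s2 [-> _]]] := IH _ _ (shift _ _ o1).
by exists (p :: s1), s2; split=> // k00; move: k0; rewrite k00.
Qed.

Lemma gap_seq_ops s : all prime s -> sorted ltn s -> ops_set (gap_seq s).
Proof.
move=> ps ss w Fw /occursP[k o].
case: Fw => [[n np wE]|[ns [_ _ [i il ile] wE]]]; move: o; rewrite wE => /occ_gap_seq[s1 [s2 [sE _]]].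
  by move: ps; rewrite sE !all_cat /= (negbTE np) /= andbF.
move: ss; rewrite sE => /cat_sorted2[_ /cat_sorted2[/(sortedP 0)/(_ i il) + _]].
by rewrite /= ltnNge ile.
Qed.

Lemma gap_seq_inj : injective gap_seq.
Proof.
have H s s' : gap_seq s = gap_seq s' -> exists s2, s' = s ++ s2.
  move=> E; have o : occ (gap_word s) (gap_seq s') 0 by rewrite -E => l _.
  by have [s1 [s2 [-> /(_ erefl) ->]]] := occ_gap_seq o; exists s2.
move=> s s' E; have [s2 E2] := H _ _ E; have [s3 E3] := H _ _ (esym E).
have := congr1 size E3; rewrite E2 !size_cat => sz.
by have/size0nil -> : size s2 = 0 by [lia]; rewrite cats0.
Qed.

Lemma size_gap_word s N : all (fun p => p <= N) s -> size (gap_word s) <= 1 + size s * N.+1.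
Proof.
elim: s => [|p s IH]; first by [].
case/andP=> pN /IH {}IH; rewrite gap_word_cons /= size_cat size_nseq; nia.
Qed.

End Words.

(** * A lower bound of Chebyshev type for the number of primes *)

Section Chebyshev.
Local Open Scope nat_scope.

Definition primes_upto (N : nat) : seq nat := [seq p <- iota 0 N.+1 | prime p].

Lemma central_binomial_ge n : 2 ^ n <= 'C(n.*2, n).
Proof.
elim: n => [|n IH] //; rewrite expnS doubleS binS.
have h1 : 'C(n.*2, n) <= 'C(n.*2.+1, n.+1) by rewrite binS leq_addl.
have h2 : 'C(n.*2, n) <= 'C(n.*2.+1, n).
  by case: (n) => [|k] //; rewrite binS leq_addr.
lia.
Qed.

Lemma divn_double_le n d : n.*2 %/ d <= (n %/ d).*2 + (d <= n.*2).
Proof.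
have [->|d0] := posnP d; first by rewrite !divn0.
have [dn|nd] := leqP d n.*2; last by rewrite divn_small.
rewrite -ltnS ltn_divLR //=; have := divn_eq n d; have := ltn_pmod n d0; nia.
Qed.

(** By Legendre's formula the exponent of [p] is a sum of differences [2n %/ p^k - 2 * (n %/ p^k)],
    each at most 1 and zero once [p^k > 2n]. The alternative is there because [p ^ 0 = 1] exceeds
    [n.*2] when [n = 0]. *)
Lemma logn_central_binomial p n : prime p -> p ^ logn p 'C(n.*2, n) <= n.*2 \/ n = 0.
Proof.
move=> pp; have [->|n0] := posnP n; [by right|left].
have n2 : 0 < n.*2 by rewrite double_gt0.
suff le : logn p 'C(n.*2, n) <= trunc_log p n.*2.
  apply: leq_trans (trunc_logP (prime_gt1 pp) n2).
  by rewrite leq_exp2l // prime_gt1.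
have := bin_fact (leq_addr n n); rewrite addnK addnn => E.
have := congr1 (logn p) E.
rewrite !lognM ?muln_gt0 ?fact_gt0 // ?bin_gt0 -?addnn ?leq_addr // addnn.
rewrite !logn_fact //.
have -> : \sum_(1 <= k < n.+1) n %/ p ^ k = \sum_(1 <= k < n.*2.+1) n %/ p ^ k.
  rewrite [RHS](@big_cat_nat _ _ _ n.+1) //=; last by rewrite ltnS -addnn leq_addr.
  rewrite [X in _ = _ + X]big1_seq ?addn0 // => k /andP[_]; rewrite mem_index_iota => /andP[nk _].
  by rewrite divn_small // (leq_ltn_trans _ (ltn_expl k (prime_gt1 pp))) // ltnW.
set S := \sum_(1 <= k < n.*2.+1) n %/ p ^ k => EE.
have : \sum_(1 <= k < n.*2.+1) n.*2 %/ p ^ k <=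
    \sum_(1 <= k < n.*2.+1) ((n %/ p ^ k).*2 + (p ^ k <= n.*2)).
  by apply: leq_sum => k _; exact: divn_double_le.
rewrite big_split /= -EE.
have -> : \sum_(1 <= k < n.*2.+1) (n %/ p ^ k).*2 = S.*2.
  by under eq_bigr do rewrite -addnn; rewrite big_split /= addnn.
have : \sum_(1 <= k < n.*2.+1) (p ^ k <= n.*2) <= trunc_log p n.*2.
  rewrite -[X in _ <= X]muln1 -[X in _ <= X * _](subn1 (trunc_log p n.*2).+1).
  rewrite -sum_nat_const_nat.
  have tl : trunc_log p n.*2 <= n.*2.
    apply: leq_trans (ltnW (ltn_expl _ (prime_gt1 pp))) (trunc_logP (prime_gt1 pp) n2).
  rewrite (@big_cat_nat _ _ _ (trunc_log p n.*2).+1) //=.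
  rewrite [X in _ + X]big1_seq ?addn0; last first.
    move=> k /andP[_]; rewrite mem_index_iota => /andP[tk _].
    case: leqP => // pk; move: tk; rewrite ltnNge => /negP[].
    exact: trunc_log_max (prime_gt1 pp) pk.
  by apply: leq_sum => k _; exact: leq_b1.
lia.
Qed.

Lemma prime_dvd_fact_leq p m : prime p -> p %| m`! -> p <= m.
Proof.
move=> pp; elim: m => [|m IH]; first by rewrite dvdn1 => /eqP pE; rewrite pE in pp.
rewrite factS Euclid_dvdM // => /orP[/dvdn_leq->//|/IH pm].
exact: leq_trans pm (leqnSn m).
Qed.

Lemma leq_prod_expn (s : seq nat) (F : nat -> nat) M :
  (forall p, p \in s -> F p <= M) -> \prod_(p <- s) F p <= M ^ size s.
Proof.
elim: s => [|p s IH] H; first by rewrite big_nil.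
rewrite big_cons expnS leq_mul ?H ?mem_head // IH // => q qs.
by rewrite H // inE qs orbT.
Qed.

(** The central binomial coefficient is at least [2 ^ n] and is a product of prime powers, each at
    most [2n], over distinct primes at most [2n]. *)
Lemma chebyshev n : 0 < n -> 2 ^ n <= n.*2 ^ size (primes_upto n.*2).
Proof.
move=> n0; apply: (leq_trans (central_binomial_ge n)).
have C0 : 0 < 'C(n.*2, n) by rewrite bin_gt0 -addnn leq_addr.
rewrite {1}(prod_prime_decomp C0) prime_decompE big_map /=.
apply: (@leq_trans (n.*2 ^ size (primes 'C(n.*2, n)))).
  apply: leq_prod_expn => p; rewrite mem_primes => /and3P[pp _ _].
  by have [//|E] := logn_central_binomial n pp; move: n0; rewrite E.
rewrite leq_pexp2l ?double_gt0 //; apply: uniq_leq_size; first exact: primes_uniq.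
move=> p; rewrite mem_primes mem_filter mem_iota => /and3P[pp _ pC]; rewrite pp /=.
rewrite add0n ltnS.
have : p %| n.*2`! by rewrite -(bin_fact (_ : n <= n.*2)) ?dvdn_mulr // -addnn leq_addr.
exact: prime_dvd_fact_leq.
Qed.

End Chebyshev.

(** * Growth *)

Lemma counting_le_card (R : realType) (T : choiceType) (A : set T) (W : finType)
    (f : T -> W) : (forall x y, A x -> A y -> f x = f y -> x = y) ->
  (counting A <= (#|W|%:R : R)%:E)%E.
Proof.
move=> finj.
have lew (s : seq T) : uniq s -> (forall x, x \in s -> A x) -> (size s <= #|W|)%N.
  move=> us sA; rewrite -(size_map f) cardE; apply: uniq_leq_size.
    by rewrite map_inj_in_uniq // => x y /sA Ax /sA Ay; exact: finj.
  by move=> w _; rewrite mem_enum.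
have fA : finite_set A.
  apply: contrapT => /(@infinite_set_fset _ _ #|W|.+1)[B BA]; apply/negP.
  by rewrite -leqNgt; apply: lew; [exact: finmap.fset_uniq|exact: BA].
rewrite /counting asboolT // lee_fin ler_nat; apply: lew; first exact: finmap.fset_uniq.
by move=> x; rewrite in_fset_set // inE.
Qed.

Lemma card_le_counting (R : realType) (T : choiceType) (A : set T) (W : finType)
    (f : W -> T) : injective f -> (forall w, A (f w)) ->
  ((#|W|%:R : R)%:E <= counting A)%E.
Proof.
move=> finj fA; rewrite /counting; case: asboolP => [finA|_]; last exact: leey.
rewrite lee_fin ler_nat cardE -(size_map f); apply: uniq_leq_size.
  by rewrite (map_inj_uniq finj) enum_uniq.
by move=> _ /mapP[w _ ->]; rewrite in_fset_set // inE.
Qed.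

(** * Encoding the balls of [GX] *)

Section Balls.

Definition GX_ball (y : X) (T : nat) : set GX :=
  [set g | gsource g = y /\ (ell g <= T)%N].

(* The list of positions of ones in the prefix of length [m <= T] is padded with [T]. *)
Definition ball_code (T K : nat) (g : GX) : 'I_T.+1 * 'I_T.+1 * {ffun 'I_K -> 'I_T.+1} :=
  let m := xget 0%N [set m | exists2 n, lag g m n & (m + n <= T)%N] in
  let n := xget 0%N [set n | lag g m n /\ (m + n <= T)%N] in
  (inord m, inord n,
   [ffun i : 'I_K => inord (nth T [seq j <- iota 0 m | letters (grange g) j] i)]).

Lemma ball_codeP y T K g : GX_ball y T g -> exists m n, [/\ lag g m n, (m + n <= T)%N &
  ball_code T K g = (inord m, inord n,
   [ffun i : 'I_K => inord (nth T [seq j <- iota 0 m | letters (grange g) j] i)])].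
Proof.
move=> [_ gT]; have [m0 [n0 [E l0]]] := ell_lag g.
rewrite /ball_code; set m := xget _ _; set n := xget _ _.
have Hm : exists2 n, lag g m n & (m + n <= T)%N.
  rewrite /m; case: xgetP => [m' _ //|/(_ m0)[]]; exists n0 => //; by rewrite E.
have Hn : lag g m n /\ (m + n <= T)%N.
  by rewrite /n; case: xgetP => [n' _ //|]; case: Hm => n' ? ? /(_ n')[].
by exists m, n; case: Hn.
Qed.

(** Given the source [y], a lag and the first [m] letters of the range determine the arrow: from
    position [m] on, the range is read off the tail of [y]. *)
Lemma ball_code_inj y T K : (forall (x : X) m, (m <= T)%N ->
    (count (letters x) (iota 0 m) <= K)%N) ->
  forall g h, GX_ball y T g -> GX_ball y T h -> ball_code T K g = ball_code T K h -> g = h.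
Proof.
move=> KP g h gb hb.
have [m [n [lg mT ->]]] := ball_codeP K gb; have [m' [n' [lh mT' ->]]] := ball_codeP K hb.
case=> /(congr1 val) /=; rewrite !inordK; [|lia|lia] => mm'.
move=> /(congr1 val) /=; rewrite !inordK; [|lia|lia] => nn'; subst m' n'.
move=> /ffunP E.
(* Since [j < m <= T], the padding value [T] is never mistaken for a position. *)
have mem (x : X) j : (j < m)%N -> letters x j <->
    exists i : 'I_K, nth T [seq j <- iota 0 m | letters x j] i = j.
  move=> jm; split=> [xj|[i ij]].
    have js : j \in [seq j <- iota 0 m | letters x j] by rewrite mem_filter xj mem_iota.
    have iK : (index j [seq j <- iota 0 m | letters x j] < K)%N.
      by rewrite (leq_trans _ (KP x m _)) ?index_mem -?size_filter ?index_mem //; lia.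
    by exists (Ordinal iK); rewrite /= nth_index.
  have [i_s|i_s] := ltnP i (size [seq j <- iota 0 m | letters x j]).
    by have := mem_nth T i_s; rewrite ij mem_filter => /andP[].
  by move: ij; rewrite nth_default //; lia.
have bnd (x : X) (i : 'I_K) : (nth T [seq j <- iota 0 m | letters x j] i < T.+1)%N.
  have [i_s|i_s] := ltnP i (size [seq j <- iota 0 m | letters x j]).
    have := mem_nth T i_s; rewrite mem_filter mem_iota add0n => /andP[_ /andP[_ im]].
    by apply: (leq_trans im); lia.
  by rewrite nth_default.
have nthE (i : 'I_K) : nth T [seq j <- iota 0 m | letters (grange g) j] i =
    nth T [seq j <- iota 0 m | letters (grange h) j] i.
  by have := congr1 val (E i); rewrite !ffunE /= !inordK.
have xyE j : (j < m)%N -> letters (grange g) j = letters (grange h) j.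
  move=> jm; apply/idP/idP => /(mem _ j jm).1 [i ij]; apply/(mem _ j jm); exists i;
    by rewrite -?nthE // nthE.
case: gb hb => sg _ [sh _]; case: lg lh => dg Eg [dh Eh].
apply: GX_eq; [|by rewrite dg dh|by rewrite sg sh].
apply: letters_inj; apply: funext => j; have [jm|mj] := ltnP j m; first exact: xyE.
by rewrite -(subnKC mj) -!letters_iter_shift Eg Eh sg sh.
Qed.

End Balls.

Section Growth.
Variable R : realType.

Lemma ell_hat_length : length_function (cover_groupoid R) (@ell_hat R).
Proof.
split=> /=.
- by move=> g; rewrite /ell_hat ler0n.
- by move=> chi; rewrite /ell_hat cover_hunit ell_unit.
- by move=> g; rewrite /ell_hat cover_hinv ell_inv.
- move=> g h gh; rewrite /ell_hat; have [-> _ _] := hmulP gh.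
  by rewrite -natrD ler_nat; apply: ell_mul; exact: composable_cover_map.
Qed.

Lemma ell_hat_locally_bounded : locally_bounded (@ell_hat R).
Proof.
move=> K cK.
apply: (compact_ind (P := fun A => exists M : R, forall g, A g -> ell_hat g <= M)) cK _ _ _ _.
- by exists 0.
- move=> A B [M fM] [N fN]; exists (Num.max M N) => t [/fM|/fN] H; apply: le_trans H _;
    by rewrite le_max lexx ?orbT.
- by move=> A B AB [M fM]; exists M => t /AB/fM.
- move=> phi _; have [u [v E]] := Ghat_Z phi.
  exists [set psi : Ghat R | app psi (indC R (Z u v)) = 1]; first exact: nbhs_indZ.
  exists (size u + size v)%:R => psi /Z_cover_map/Z_lag/ell_le.
  by rewrite /ell_hat ler_nat.
Qed.

(** All arrows with source [chi] lie over arrows with the same source [y], and distinct ones lie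
    over distinct arrows by [Ghat_eq]. The exponent [K + 2] counts the two numbers of the lag and
    the [K] positions. *)
Lemma ball_growth (chi : Xhat R) (t : R) (K : nat) : 0 <= t ->
  (forall (x : X) m, (m <= Num.truncn t)%N -> (count (letters x) (iota 0 m) <= K)%N) ->
  (counting (fibre_ball (cover_groupoid R) (@ell_hat R) chi t) <=
    (((Num.truncn t).+1 ^ K.+2)%:R : R)%:E)%E.
Proof.
move=> t0 KP; set T := Num.truncn t.
pose y := gsource (cover_map (hunit chi)).
have yP (phi : Ghat R) : hsrc phi = chi -> gsource (cover_map phi) = y.
  by rewrite /y => <-; rewrite cover_hunit_hsrc.
have bP phi : fibre_ball (cover_groupoid R) (@ell_hat R) chi t phi -> GX_ball y T (cover_map phi).
  case=> /= s l; split; first exact: yP.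
  by rewrite truncn_ge_nat.
have -> : ((T.+1 ^ K.+2)%N = #|{: 'I_T.+1 * 'I_T.+1 * {ffun 'I_K -> 'I_T.+1}}|)%N.
  by rewrite !card_prod card_ffun !card_ord !expnS mulnA.
apply: (@counting_le_card R _ _ _ (fun phi : Ghat R => ball_code T K (cover_map phi))).
move=> phi psi bphi bpsi; move/(ball_code_inj KP (bP _ bphi) (bP _ bpsi)) => c.
by case: bphi bpsi => /= s1 _ [/= s2 _]; apply: Ghat_eq => //; rewrite s1 s2.
Qed.

(** Put [q = t^(1/4)]. For [t >= 1] one has [1 + t <= (1 + q)^4 <= exp (4 * q)] and
    [K + 2 <= 5 * q^2], so [(T + 1)^(K + 2)] is at most [exp (20 * q^3)]. *)
Lemma cover_groupoid_subexponential : strong_subexponential_growth (cover_groupoid R) (@ell_hat R).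
Proof.
exists 1, 20, (3 / 4); split=> //; first by apply/andP; split; lra.
move=> t t0; apply: ge_ereal_sup => _ [chi _ <-].
pose q := t `^ 4^-1; have q0 : 0 <= q by exact: powR_ge0.
have q4 : q ^+ 4 = t by rewrite -powR_mulrn // -powRrM mulVf // powRr1.
have q3 : q ^+ 3 = t `^ (3 / 4) by rewrite -powR_mulrn // -powRrM mulrC.
set T := Num.truncn t.
have Tt : T%:R <= t by rewrite -truncn_ge_nat.
pose K := (Num.truncn (2 * q ^+ 2)).+1.
have K2 : K%:R <= 1 + 2 * q ^+ 2.
  rewrite /K -addn1 natrD addrC lerD2l -truncn_ge_nat //.
  by rewrite mulr_ge0 // exprn_ge0.
have KP (x : X) m : (m <= T)%N -> (count (letters x) (iota 0 m) <= K)%N.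
  move=> mT; have := ones_bound x m; set c := count _ _ => cm.
  suff : (c.-1 <= Num.truncn (2 * q ^+ 2))%N by rewrite /K; lia.
  rewrite truncn_ge_nat; last by rewrite mulr_ge0 // exprn_ge0.
  rewrite -(@ler_pXn2r _ 2) ?nnegrE ?mulr_ge0 ?exprn_ge0 //.
  rewrite exprMn -exprM q4 -natrX.
  apply: (@le_trans _ _ (2 * T)%:R); first by rewrite ler_nat; lia.
  by rewrite natrM; lra.
apply: (le_trans (ball_growth chi t0 KP)); rewrite lee_fin mul1r -q3.
(* For [T = 0] the count is 1. Otherwise [q >= 1], and the constant 3 in [K + 2 <= 3 + 2 * q^2] is
   absorbed by [3 * q^2]. *)
rewrite -/T; have [->|T0] := posnP T.
  by rewrite exp1n -[leLHS]expR0 ler_expR mulr_ge0 // exprn_ge0.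
have q1 : 1 <= q.
  rewrite leNgt; apply/negP => q1.
  have : t < 1 by rewrite -q4 exprn_ilt1.
  have : (1 : R) <= T%:R by rewrite ler1n.
  lra.
rewrite natrX -natr1.
apply: (@le_trans _ _ (expR (4 * q) ^+ K.+2)).
  rewrite lerXn2r ?nnegrE ?expR_ge0 ?addr_ge0 //.
  apply: (@le_trans _ _ ((1 + q) ^+ 4)).
    apply: (@le_trans _ _ (q ^+ 4 + 1)); first by rewrite q4 lerD2r.
    have q2 : 0 <= q ^+ 2 by rewrite exprn_ge0.
    have q3' : 0 <= q ^+ 3 by rewrite exprn_ge0.
    have -> : (1 + q) ^+ 4 = q ^+ 4 + 1 + (4 * q + 6 * q ^+ 2 + 4 * q ^+ 3) by ring.
    lra.
  rewrite expRM_natl lerXn2r ?nnegrE ?expR_ge0 ?addr_ge0 //.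
  exact: expR_ge1Dx.
rewrite -expRM_natl ler_expR.
have : K.+2%:R <= 5 * q ^+ 2 :> R.
  rewrite -addn2 natrD; have : 1 <= q ^+ 2 by rewrite exprn_ege1.
  lra.
move=> K5; rewrite mulrC.
have -> : 20 * q ^+ 3 = 4 * q * (5 * q ^+ 2) :> R by ring.
by rewrite ler_pM2l // mulr_gt0 // (lt_le_trans ltr01).
Qed.

Definition gap_point s (ps : all prime s) (ss : sorted ltn s) : X :=
  exist _ (gap_seq s) (mem_set (gap_seq_ops ps ss)).

Lemma shift_gap_point s (ps : all prime s) (ss : sorted ltn s) :
  iter (size (gap_word s)) shift (gap_point ps ss) = iter 0 shift Xzero.
Proof.
apply: letters_inj; apply: funext => i; rewrite letters_iter_shift.
change (gap_seq s (size (gap_word s) + i)%N = false).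
by rewrite /gap_seq nth_default // leq_addr.
Qed.

Lemma gap_arrow_subproof s (ps : all prime s) (ss : sorted ltn s) :
  exists m n : nat, (size (gap_word s))%:Z = m%:Z - n%:Z :> int /\
    iter m shift (gap_point ps ss) = iter n shift Xzero.
Proof.
exists (size (gap_word s)), 0%N; rewrite subr0; split=> //.
exact: shift_gap_point.
Qed.

(** A bit mask selects primes in increasing order, so the gap point lies in [X]. Evaluations carry
    the resulting arrows of [GX] into one fibre of the cover, and [cover_map] keeps them
    distinct. *)
Lemma cover_groupoid_ball_ge (N : nat) (t : R) :
  (1 + size (primes_upto N) * N.+1)%:R <= t ->
  (((2 ^ size (primes_upto N))%:R : R)%:E <= growth (cover_groupoid R) (@ell_hat R) t)%E.
Proof.
set P := primes_upto N => Lt.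
apply: le_trans (ereal_sup_ubound (imageP _ (I : [set: Xhat R] (evalX R Xzero)))).
have Pp (m : bitseq) : all prime (mask m P).
  by apply/allP => p /mem_mask; rewrite mem_filter => /andP[].
have Ps (m : bitseq) : sorted ltn (mask m P).
  apply: (sorted_mask ltn_trans); apply: (sorted_filter ltn_trans).
  exact: iota_ltn_sorted.
pose g (m : (size P).-tuple bool) := MkGX (gap_arrow_subproof (Pp m) (Ps m)).
have -> : (2 ^ size P)%N = #|{: (size P).-tuple bool}|.
  by rewrite card_tuple card_bool.
apply: (@card_le_counting R _ _ _ (fun m => evalG R (g m))).
  move=> m m' /(congr1 (@cover_map R)).
  rewrite !(cover_map_eval (evalGP _)) => /(congr1 grange)/(congr1 letters) E.
  have {}E : mask m P = mask m' P := gap_seq_inj E.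
  apply: val_inj; apply: (@eq_from_nth _ false); rewrite !size_tuple // => i iP.
  have uP : uniq P by rewrite filter_uniq // iota_uniq.
  (* As [P] has no repetitions, a bit of the mask is the membership of the corresponding prime in
     the selected list. *)
  have H (b : (size P).-tuple bool) : nth false b i = (nth 0%N P i \in mask b P).
    by rewrite in_mask // mem_nth //= index_uniq.
  by rewrite !H E.
move=> m; split=> /=.
  have ex := cover_groupoid_extension R.
  have h1 := @extension_src R (cover_groupoid R) ex (g m) (evalG R (g m)) (@evalGP R (g m)).
  exact: (is_evaluation_unique h1 (@evalXP R Xzero)).
rewrite /ell_hat (cover_map_eval (@evalGP R _)); apply: le_trans Lt; rewrite ler_nat.
have : lag (g m) (size (gap_word (mask m P))) 0.
  by split; [rewrite subr0|exact: shift_gap_point].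
move=> /ell_le le1; apply: (leq_trans le1); rewrite addn0.
apply: (@leq_trans (1 + size (mask m P) * N.+1)).
  apply: size_gap_word; apply/allP => p /mem_mask; rewrite mem_filter mem_iota.
  by case/andP=> _; rewrite add0n ltnS.
by rewrite leq_add2l leq_mul2r (size_subseq (mask_subseq _ _)) orbT.
Qed.

(** With [j] a multiple of 8, raising [m] by one multiplies the right side by 256, far more than the
    growth of the cubic on the left. *)
Lemma exp2_beats_quadratic (M : nat) : exists j, (M * j.+1 ^ 2 < 2 ^ j)%N.
Proof.
exists (8 * M.+1)%N.
suff H : forall m, (m.+1 * (8 * m.+1).+1 ^ 2 <= 2 ^ (8 * m.+1))%N.
  by apply: leq_trans (H M); rewrite ltn_pmul2r ?expn_gt0.
elim=> [//|m IH]; rewrite (_ : 8 * m.+2 = 8 + 8 * m.+1)%N; last by lia.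
rewrite expnD; apply: leq_trans (leq_mul (leqnn (2 ^ 8)) IH).
rewrite (_ : 2 ^ 8 = 256)%N //; rewrite -!mulnn; nia.
Qed.

(** Take [N = 2^(j+1)], so that Chebyshev reads [2^j <= (j + 1) * k]. The radius satisfies
    [1 + L <= N^4], so a polynomial bound stays below [2^(c + 1 + 4 * d * (j + 1))]. This is at most
    [2^k] once [(4 * d + c + 1) * (j + 1)^2 < 2^j], which fixes the choice of [j]. *)
Lemma cover_groupoid_not_polynomial : ~ polynomial_growth (cover_groupoid R) (@ell_hat R).
Proof.
move=> [C [d [C0 H]]].
pose c := Num.truncn C.
have Cc : C < (2 ^ c.+1)%:R.
  apply: (lt_trans (truncnS_gt C)); rewrite ltr_nat; exact: ltn_expl.
have [j jP] := exp2_beats_quadratic (4 * d + c.+1).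
pose N := (2 ^ j).*2; pose k := size (primes_upto N).
have kP : (2 ^ j <= j.+1 * k)%N.
  have := chebyshev (expn_gt0 2 j : (0 < 2 ^ j)%N).
  by rewrite -/N -/k /N -mul2n -expnS -expnM leq_exp2l.
have k1 : (k <= N.+1)%N.
  by rewrite /k /primes_upto size_filter (leq_trans (count_size _ _)) // size_iota.
pose L := (1 + k * N.+1)%N.
have := H L%:R (ler0n _ _); apply/negP; rewrite -ltNge.
apply: lt_le_trans (cover_groupoid_ball_ge (lexx _)); rewrite lte_fin -/k.
have NE : N = (2 ^ j.+1)%N by rewrite /N -mul2n expnS.
have N2 : (2 <= N)%N by rewrite NE expnS leq_pmulr ?expn_gt0.
have L4 : (1 + L <= N ^ 4)%N.
  have : (1 + L <= 2 + N.+1 * N.+1)%N by rewrite /L; nia.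
  move=> LN; apply: (leq_trans LN); rewrite !expnS expn0; nia.
apply: (@lt_le_trans _ _ ((2 ^ c.+1) * (N ^ 4) ^ d)%N%:R).
  rewrite natrM; apply: (@lt_le_trans _ _ ((2 ^ c.+1)%:R * (1 + L%:R) ^+ d)).
    by rewrite ltr_pM2r // exprn_gt0 // ltr_pwDl.
  rewrite ler_pM2l ?ltr0n ?expn_gt0 // natrX lerXn2r ?nnegrE ?addr_ge0 //.
  by rewrite -(natrD _ 1) ler_nat.
rewrite ler_nat NE -!expnM -expnD leq_exp2l //.
move: jP kP; nia.
Qed.

End Growth.

Theorem theorem2 (R : realType) :
  exists G : groupoid_ops (Xhat R) (Ghat R),
    continuous_extension G /\
    (forall G' : groupoid_ops (Xhat R) (Ghat R),
       continuous_extension G' -> same_groupoid G G') /\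
    etale_groupoid G /\
    length_function G (@ell_hat R) /\
    locally_bounded (@ell_hat R) /\
    strong_subexponential_growth G (@ell_hat R) /\
    ~ polynomial_growth G (@ell_hat R).
Proof.
exists (cover_groupoid R); split; first exact: cover_groupoid_extension.
split; first exact: extension_unique.
split; first exact: cover_groupoid_etale.
split; first exact: ell_hat_length.
split; first exact: ell_hat_locally_bounded.
split; [exact: cover_groupoid_subexponential|exact: cover_groupoid_not_polynomial].
Qed.
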